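(* Let $G$ be a graph, let $b$ and $m$ be positive integers, and let $f$ be a positive integer-valued function on $V(G)$ with $2m\le f(v)\le b$ for every vertex $v$. If $G$ is $b^2$-tough and $|V(G)|\ge b^2$, then $G$ has an $m$-tree-connected $\{f,f+1\}$-factor, that is, an $m$-tree-connected spanning subgraph $H$ such that $d_H(v)\in\{f(v),f(v)+1\}$ for each vertex $v$.
   Context: Graphs are finite, have no loops, and may have multiple edges. $d_H(v)$ is the number of edges of $H$ incident to $v$. A graph is $m$-tree-connected if it has $m$ edge-disjoint spanning trees. For a positive real $t$, $G$ is $t$-tough if $\omega(G\setminus S)\le\max\{1,\frac1t|S|\}$ for all $S\subseteq V(G)$, where $\omega$ denotes the number of components and $G\setminus S$ is obtained by deleting the vertices of $S$. *)

(* Defs.v *)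
From mathcomp Require Import all_boot all_order all_algebra.
Set Implicit Arguments. Unset Strict Implicit. Unset Printing Implicit Defensive.

(* Finite loopless multigraphs: parallel edges are distinct elements of [edge]
   with the same pair of ends. *)
Record mgraph := MGraph {
  vert :> finType;
  edge : finType;
  ends : edge -> {set vert};
  endsP : forall e : edge, #|ends e| = 2
}.

(* A spanning subgraph of [G] is identified with its edge set
   [F : {set edge G}], its vertex set being the whole of [G]. *)

Definition deg (G : mgraph) (F : {set edge G}) (v : G) : nat :=
  #|[set e in F | v \in ends e]|.

(* Adjacency in the subgraph with edge set F and vertex set restricted to X. *)
Definition adj (G : mgraph) (F : {set edge G}) (X : {set G}) : rel G :=
  [rel x y | [&& x \in X, y \in X & [exists e in F, ends e == [set x; y]]]].

Definition connectedg (G : mgraph) (F : {set edge G}) : Prop :=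
  forall x y : G, connect (adj F [set: G]) x y.

(* v 0, e 0, v 1, e 1, ..., v (k-1), e (k-1), v 0 is a cycle with edges in F
   ([ordS] is the cyclic successor); pairs of parallel edges are the cycles
   with k = 2, and k = 1 is ruled out by [endsP]. *)
Definition is_cycle (G : mgraph) (F : {set edge G}) (k : nat)
    (v : 'I_k -> G) (e : 'I_k -> edge G) : Prop :=
  [/\ 0 < k, injective v, injective e &
      forall i : 'I_k, e i \in F /\ ends (e i) = [set v i; v (ordS i)]].

Definition acyclic (G : mgraph) (F : {set edge G}) : Prop :=
  forall (k : nat) (v : 'I_k -> G) (e : 'I_k -> edge G), ~ is_cycle F v e.

Definition spanning_tree (G : mgraph) (T : {set edge G}) : Prop :=
  connectedg T /\ acyclic T.

Definition tree_connected (G : mgraph) (m : nat) (F : {set edge G}) : Prop :=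
  exists T : 'I_m -> {set edge G},
    [/\ forall i, T i \subset F,
        forall i j, i != j -> [disjoint T i & T j] &
        forall i, spanning_tree (T i)].

(* Number of components of G with the vertices of S deleted; [~: S] is closed
   under the restricted adjacency, as [n_comp] requires. *)
Definition omega (G : mgraph) (S : {set G}) : nat :=
  n_comp (adj [set: edge G] (~: S)) (~: S).

Definition tough (R : realFieldType) (t : R) (G : mgraph) : Prop :=
  forall S : {set G},
    ((omega S)%:R <= Num.max 1 (t^-1 * #|S|%:R) :> R)%R.

Definition factor_f_f1 (G : mgraph) (f : G -> nat) (F : {set edge G}) : Prop :=
  forall v : G, deg F v = f v \/ deg F v = (f v).+1.

(* Main.v *)
Require Import Defs.
From mathcomp Require Import all_boot all_order all_algebra.
From mathcomp Require Import zify.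
Set Implicit Arguments. Unset Strict Implicit. Unset Printing Implicit Defensive.
Import Order.TTheory GRing.Theory Num.Theory.

(* The factor is [F :|: M], where [F] is a simple spanning subgraph with degrees [f], except
   that one vertex may have degree [f + 1], and [M] is a matching avoiding that vertex.

   If [F] did not exist, the Tutte-Berge formula in Tutte's gadget graph would give disjoint
   [S] and [T] with [2 + f(S) + sum_T (d_(G-S) - f) <= omega(G - S - T)].  Deleting [S] together
   with the neighbours of a greedily chosen independent subset of [T] contradicts toughness.

   Call an edge set sparse if every nonempty vertex set [X] spans at most [m(|X| - 1)] of its
   edges, and [X] tight if equality holds.  Let [F0] be a maximal sparse subset of [F] and
   choose [M] of maximum size with [F0 :|: M] sparse.  If the whole vertex set is not tight,
   exchanging edges of [M] as in Win's theorem yields a set [S] of matched vertices such that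
   every edge of [G - S] outside [F :|: M] lies in a tight set of [F0 :|: {e in M | e avoids S}].
   As [F] is simple with degrees at least [2m], a maximal tight set with at most [2m] vertices
   is left by at least [2m] edges of [F].  Counting edges then shows that deleting [S] and one
   end of each edge leaving a tight part with more than [2m] vertices leaves too many
   components.

   A sparse set with [m(n - 1)] edges has an orientation in which every vertex other than a
   root has indegree [m], and Edmonds' branching theorem splits it into [m] spanning trees. *)

(** * Sparse edge sets and tight vertex sets *)

Section Sparse.
Variables (V E : finType) (m : nat).
Variable ends : E -> {set V}.
Implicit Types (A : {set E}) (X Y Z D : {set V}).

Definition inside A X : {set E} := [set e in A | ends e \subset X].

(** When edges have two ends, these are by Nash-Williams the independent sets of the union of [m]
    graphic matroids. The [m] on the left avoids a truncated subtraction. *)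
Definition sparse A : bool :=
  [forall X : {set V}, (X != set0) ==> (#|inside A X| + m <= m * #|X|)].

Definition tight A X : bool :=
  (X != set0) && (#|inside A X| + m == m * #|X|).

Lemma sparseP A :
  reflect (forall X, X != set0 -> #|inside A X| + m <= m * #|X|) (sparse A).
Proof.
by apply: (iffP forallP) => H X; [move=> X0; have /implyP := H X; apply | apply/implyP/H].
Qed.

Lemma tightP A X :
  reflect (X != set0 /\ #|inside A X| + m = m * #|X|) (tight A X).
Proof. by apply: (iffP andP) => -[-> /eqP]. Qed.

Lemma insideS A A' X Y : A \subset A' -> X \subset Y -> inside A X \subset inside A' Y.
Proof.
move=> sA sX; apply/subsetP => e; rewrite !inE => /andP[eA eX].
by rewrite (subsetP sA) //= (subset_trans eX).
Qed.

Lemma inside_supermod A X Y :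
  #|inside A X| + #|inside A Y| <= #|inside A (X :|: Y)| + #|inside A (X :&: Y)|.
Proof.
rewrite -cardsUI leq_add ?subset_leq_card //.
  by rewrite subUset !insideS // ?subsetUl ?subsetUr.
by apply/subsetP => e; rewrite !inE subsetI => /andP[/andP[-> ->] /andP[_ ->]].
Qed.

Lemma sparse_sub A A' : A \subset A' -> sparse A' -> sparse A.
Proof.
move=> sA /sparseP sp; apply/sparseP => X X0; apply: leq_trans (sp X X0).
by rewrite leq_add2r subset_leq_card // insideS.
Qed.

Lemma sub_tight A A' X : A \subset A' -> sparse A' -> tight A X -> tight A' X.
Proof.
move=> sA /sparseP sp /tightP[X0 tX]; apply/tightP; split=> //.
by apply/eqP; rewrite eqn_leq sp // -tX leq_add2r subset_leq_card // insideS.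
Qed.

(** Inside counts are supermodular and cardinality is modular, so two tight sets leave no slack for
    their union and intersection. Sparsity bounds the intersection only if it is nonempty. *)
Lemma tightUI A X Y : sparse A -> tight A X -> tight A Y -> X :&: Y != set0 ->
  tight A (X :|: Y) && tight A (X :&: Y).
Proof.
move=> /sparseP sp /tightP[X0 tX] /tightP[Y0 tY] XY0.
have XU0 : X :|: Y != set0 by apply: contraNneq XY0 => /eqP; rewrite setU_eq0 => /andP[/eqP-> _];
  rewrite set0I.
have := inside_supermod A X Y; have := sp _ XU0; have := sp _ XY0; have := cardsUI X Y.
rewrite /tight XU0 XY0 /=; nia.
Qed.

Lemma tightU A X Y : sparse A -> tight A X -> tight A Y -> X :&: Y != set0 -> tight A (X :|: Y).
Proof. by move=> sp tX tY /(tightUI sp tX tY)/andP[]. Qed.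

Lemma tightI A X Y : sparse A -> tight A X -> tight A Y -> X :&: Y != set0 -> tight A (X :&: Y).
Proof. by move=> sp tX tY /(tightUI sp tX tY)/andP[]. Qed.

Lemma sparse0 : sparse set0.
Proof.
apply/sparseP => X X0; have /eqP -> : #|inside set0 X| == 0 by rewrite cards_eq0;
  apply/eqP/setP => e; rewrite !inE.
by rewrite -card_gt0 in X0; nia.
Qed.

Lemma tight1 A x : (forall e, #|ends e| = 2) -> tight A [set x].
Proof.
move=> ends2; apply/tightP; split; first by apply/set0Pn; exists x; rewrite inE.
rewrite cards1 muln1; suff -> : inside A [set x] = set0 by rewrite cards0.
apply/setP => e; rewrite !inE; apply/negP => /andP[_ /subset_leq_card].
by rewrite ends2 cards1.
Qed.

(** A smallest tight set around [D] is the least one, because its intersection with any other is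
    again tight. For [D] the ends of a new edge, [Z] spans the edges that may be traded for it. *)
Lemma tight_min A X D : sparse A -> tight A X -> D \subset X -> D != set0 ->
  exists Z, [/\ tight A Z, D \subset Z & forall Y, tight A Y -> D \subset Y -> Z \subset Y].
Proof.
move=> sp tX DX D0.
case: (@arg_minnP _ X (fun Y => tight A Y && (D \subset Y)) (fun Y => #|Y|)); first by rewrite tX.
move=> Z /andP[tZ DZ] minZ; exists Z; split=> // Y tY DY.
have DI : D \subset Z :&: Y by rewrite subsetI DZ.
have I0 : Z :&: Y != set0 by apply: contraNneq D0 => I0; rewrite -subset0 -I0.
have := minZ (Z :&: Y); rewrite tightI //= DI => /(_ isT) le.
by apply/setIidPl/eqP; rewrite eqEcard subsetIl.
Qed.

Lemma card_insideU1 A e X : e \notin A ->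
  #|inside (e |: A) X| = (ends e \subset X) + #|inside A X|.
Proof.
move=> eA; case: (boolP (ends e \subset X)) => eX.
  have -> : inside (e |: A) X = e |: inside A X.
    by apply/setP => e'; rewrite !inE; case: eqP => // ->; rewrite eX.
  by rewrite cardsU1 inE (negbTE eA).
have -> // : inside (e |: A) X = inside A X.
by apply/setP => e'; rewrite !inE; case: eqP => // ->; rewrite (negbTE eX) !andbF.
Qed.

Lemma card_insideD1 A e X : e \in A ->
  #|inside A X| = (ends e \subset X) + #|inside (A :\ e) X|.
Proof. by move=> eA; rewrite -{1}(setD1K eA) card_insideU1 // !inE eqxx. Qed.

Lemma sparse_add A e : sparse A -> e \notin A ->
  (forall X, tight A X -> ~~ (ends e \subset X)) -> sparse (e |: A).
Proof.
move=> /sparseP sp eA nt; apply/sparseP => X X0; rewrite card_insideU1 //.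
have := sp X X0; case: (boolP (ends e \subset X)) => //= eX.
rewrite leq_eqVlt => /orP[/eqP tX|//].
by have /nt := introT (tightP A X) (conj X0 tX); rewrite eX.
Qed.

(** A set tight without [e'] is tight in [A]. If it spanned [e] it would include [Z], hence span
    [e'], and deleting [e'] would have destroyed its tightness. *)
Lemma sparse_exchange A Z e e' : sparse A -> e \notin A ->
  (forall Y, tight A Y -> ends e \subset Y -> Z \subset Y) -> e' \in inside A Z ->
  sparse (e |: A :\ e').
Proof.
move=> sp eA minZ; rewrite inE => /andP[e'A e'Z].
apply: sparse_add; first by apply: sparse_sub sp; apply: subsetDl.
  by rewrite !inE negb_and eA orbT.
move=> X tX; apply/negP => eX.
have tX' : tight A X by apply: sub_tight tX => //; apply: subsetDl.
have eX' := subset_trans e'Z (minZ X tX' eX).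
case/tightP: tX' => _; case/tightP: tX => _.
by rewrite (card_insideD1 X e'A) eX'; lia.
Qed.

End Sparse.

(** * Freeing vertices from a maximum matching *)

Lemma card_diff_in (E : finType) (A B : {set E}) (Q : pred E) :
  #|A| = #|B| -> (forall e, (e \in A) != (e \in B) -> Q e) ->
  #|[set e in A | Q e]| = #|[set e in B | Q e]|.
Proof.
move=> AB dif.
have split (C : {set E}) : #|C| = #|[set e in C | Q e]| + #|[set e in C | ~~ Q e]|.
  rewrite -(cardsID [set e | Q e] C); congr (_ + _); apply: eq_card => e; rewrite !inE //.
  by rewrite andbC.
have: [set e in A | ~~ Q e] = [set e in B | ~~ Q e].
  apply/setP => e; rewrite !inE; case: (boolP (Q e)); rewrite ?andbF ?andbT // => nQ.
  by apply/eqP; apply: contraNT nQ; apply: dif.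
by move=> eqN; move: AB; rewrite (split A) (split B) eqN => /addIn.
Qed.

Section Replace.
Variables (V E : finType) (m : nat) (ends : E -> {set V}).
Hypothesis ends2 : forall e, #|ends e| = 2.
Implicit Types (A B C : {set E}) (X Y Z : {set V}).

(** Inside a set tight for both, [A] may be overwritten by [B]. For [Y] meeting [X], supermodularity
    applies: [C] agrees with [B] inside [X] and [X :&: Y], and has as many edges as [A] inside
    [X :|: Y]. *)
Lemma sparse_replace A B C X : sparse m ends A -> tight m ends A X ->
  sparse m ends B -> tight m ends B X ->
  (forall e, ends e \subset X -> (e \in C) = (e \in B)) ->
  (forall e, ~~ (ends e \subset X) -> (e \in C) = (e \in A)) -> sparse m ends C.
Proof.
move=> /sparseP spA /tightP[X0 tA] /sparseP spB /tightP[_ tB] inX offX.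
apply/sparseP => Y Y0; case: (eqVneq (X :&: Y) set0) => [XY0|XY0].
  suff -> : inside ends C Y = inside ends A Y by apply: spA.
  apply/setP => e; rewrite !inE; case: (boolP (ends e \subset Y)) => eY; rewrite ?andbF //.
  case: (boolP (ends e \subset X)) => eX; last by rewrite offX.
  have : ends e \subset X :&: Y by rewrite subsetI eX.
  by rewrite XY0 subset0 -cards_eq0 ends2.
have cXB : inside ends C X = inside ends B X.
  by apply/setP => e; rewrite !inE; case: (boolP (ends e \subset X)) => eX; rewrite ?andbF // inX.
have cI : inside ends C (X :&: Y) = inside ends B (X :&: Y).
  apply/setP => e; rewrite !inE; case: (boolP (ends e \subset _)); rewrite ?andbF //.
  by rewrite subsetI => /andP[eX _]; rewrite inX.
have cU : #|inside ends C (X :|: Y)| = #|inside ends A (X :|: Y)|.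
  rewrite -(cardsID (inside ends C X)) -(cardsID (inside ends A X) (inside ends A _)).
  have insI (D : {set E}) : inside ends D (X :|: Y) :&: inside ends D X = inside ends D X.
    by apply/setIidPr; rewrite insideS ?subsetUl.
  rewrite !insI cXB; congr (_ + _); first by move: tA tB; lia.
  apply: eq_card => e; rewrite !inE; case: (boolP (ends e \subset X)) => eX;
    last by rewrite offX ?andbF.
  by rewrite (inX _ eX) !andbT !andbA !andNb.
have U0 : X :|: Y != set0 by apply: contraNneq XY0 => /eqP; rewrite setU_eq0 => /andP[/eqP-> _];
  rewrite set0I.
have := inside_supermod ends C X Y; have := cardsUI X Y.
have := spA _ U0; have := spB _ XY0; rewrite cI cU cXB; nia.
Qed.

End Replace.

(* Throughout, [A :\: F0] is a matching with edges in [L], and [Z0] consists of vertices that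
   no edge of [L] may use. *)
Section Exchange.
Variables (V E : finType) (m : nat) (ends : E -> {set V}).
Hypothesis ends2 : forall e, #|ends e| = 2.
Variables (F0 L : {set E}) (Z0 : {set V}).
Hypothesis LF0 : [disjoint L & F0].
Hypothesis LZ0 : forall e, e \in L -> [disjoint ends e & Z0].
Implicit Types (A B C : {set E}) (S X Y Z : {set V}).

Definition matching A : Prop :=
  forall e e' v, e \in A -> e' \in A -> v \in ends e -> v \in ends e' -> e = e'.

Definition feasible A : Prop :=
  [/\ F0 \subset A, A :\: F0 \subset L, sparse m ends A & matching (A :\: F0)].

Definition uncovered A v : Prop := forall e, e \in A :\: F0 -> v \notin ends e.

Definition avoid A S : {set E} := [set e in A | (e \in F0) || (ends e \subset ~: S)].

(* Every vertex outside [S] can be left unmatched by rearranging the matching [A :\: F0] only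
   inside a tight set and away from [S]; shrinking [S] preserves what is already freeable. *)
Definition freeable A S : Prop := forall v, v \notin S -> exists X B,
  [/\ v \in X, tight m ends (avoid A S) X, feasible B, #|B| = #|A| /\ uncovered B v &
      forall e, (e \in A) != (e \in B) -> ends e \subset X :\: S].

Definition spanned_off A S : bool :=
  [forall e, [&& e \in L, e \notin A & ends e \subset ~: S] ==>
     [exists X : {set V}, tight m ends (avoid A S) X && (ends e \subset X)]].

Lemma avoid_sub A S : avoid A S \subset A.
Proof. by apply/subsetP => e; rewrite inE => /andP[]. Qed.

Lemma avoidS A S S' : S' \subset S -> avoid A S \subset avoid A S'.
Proof.
move=> sS; apply/subsetP => e; rewrite !inE => /andP[-> /orP[->//|eS]] /=.
by rewrite (subset_trans eS) ?orbT // setCS.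
Qed.

Lemma card_avoid_inside A B S W :
  #|A| = #|B| -> (forall e, (e \in A) != (e \in B) -> ends e \subset W :\: S) ->
  #|inside ends (avoid A S) W| = #|inside ends (avoid B S) W|.
Proof.
move=> AB dif.
have eq C : inside ends (avoid C S) W =
    [set e in C | ((e \in F0) || (ends e \subset ~: S)) && (ends e \subset W)].
  by apply/setP => e; rewrite !inE andbA.
rewrite !eq; apply: card_diff_in => // e /dif; rewrite setDE subsetI => /andP[-> ->].
by rewrite orbT.
Qed.

Lemma tight_avoid A B S W :
  #|A| = #|B| -> (forall e, (e \in A) != (e \in B) -> ends e \subset W :\: S) ->
  tight m ends (avoid A S) W = tight m ends (avoid B S) W.
Proof. by move=> AB dif; rewrite /tight (card_avoid_inside AB dif). Qed.

(** Let [e] violate [spanned_off]. Both its ends can be freed at once; maximality of [A] then yields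
    a tight set around [e], and the matching edges inside the least such set can be traded for [e],
    which makes their ends freeable. *)
Lemma win_step A S : feasible A -> (forall B, feasible B -> #|B| <= #|A|) ->
  Z0 \subset S -> freeable A S -> ~~ spanned_off A S ->
  exists S', [/\ Z0 \subset S', S' \proper S & freeable A S'].
Proof.
move=> [F0A AL spA maA] maxA ZS frS.
rewrite /spanned_off => /forallPn[e eP]; move: eP;
  rewrite negb_imply => /andP[/and3P[eL eA eS] /existsPn noT].
have /eqP/cards2P[x [y [xy eE]]] := ends2 e.
have xe : x \in ends e by rewrite eE !inE eqxx.
have ye : y \in ends e by rewrite eE !inE eqxx orbT.
have eF : e \notin F0 by rewrite (disjointFr LF0 eL).
have xS : x \notin S by move/subsetP/(_ x xe): eS; rewrite inE.
have yS : y \notin S by move/subsetP/(_ y ye): eS; rewrite inE.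
have [X [Bx [xX tX [F0Bx BxL spBx maBx] [cBx frx] difx]]] := frS x xS.
have [Y [By [yY tY [F0By ByL spBy maBy] [cBy fry] dify]]] := frS y yS.
have spK : sparse m ends (avoid A S) by apply: sparse_sub spA; apply: avoid_sub.
have XY : X :&: Y = set0.
  apply/eqP; apply/negPn/negP => XY0; have := noT (X :|: Y).
  by rewrite (tightU spK) // eE subUset !sub1set !inE xX yY orbT.
have offx g : ~~ (ends g \subset X) -> (g \in Bx) = (g \in A).
  move=> gX; apply/eqP; apply: contraNT gX; rewrite eq_sym => /difx.
  by rewrite subsetD => /andP[].
have offy g : ~~ (ends g \subset Y) -> (g \in By) = (g \in A).
  move=> gY; apply/eqP; apply: contraNT gY; rewrite eq_sym => /dify.
  by rewrite subsetD => /andP[].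
have dXY g : ends g \subset X -> ends g \subset Y -> False.
  move=> gX gY; have : ends g \subset X :&: Y by rewrite subsetI gX.
  by rewrite XY subset0 -cards_eq0 ends2.
(* [C] carries out the exchanges freeing [x] and [y] at once: they live in the disjoint
   tight sets [X] and [Y]. *)
have [C CX CnX] : exists2 C : {set E},
    forall g, ends g \subset X -> (g \in C) = (g \in Bx)
  & forall g, ~~ (ends g \subset X) -> (g \in C) = (g \in By).
  exists [set g | if ends g \subset X then g \in Bx else g \in By] => g gX; rewrite inE.
    by rewrite gX.
  by rewrite (negbTE gX).
have CY g : ~~ (ends g \subset Y) -> (g \in C) = (g \in Bx).
  move=> gY; case: (boolP (ends g \subset X)) => gX; first exact: CX.
  by rewrite CnX // offy // offx.
have vX g v : v \in ends g -> v \notin Y -> (g \in C) = (g \in Bx).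
  by move=> vg vY; apply: CY; apply: contraNN vY => /subsetP; apply.
have vY g v : v \in ends g -> v \notin X -> (g \in C) = (g \in By).
  by move=> vg vX'; apply: CnX; apply: contraNN vX' => /subsetP; apply.
have tAX : tight m ends A X by apply: sub_tight tX => //; apply: avoid_sub.
have tAY : tight m ends A Y by apply: sub_tight tY => //; apply: avoid_sub.
have inY g : ends g \subset Y -> (g \in C) = (g \in By).
  by move=> gY; apply: CnX; apply/negP => gX; apply: (dXY g).
have cinE (D : {set E}) W : inside ends D W = [set g in D | ends g \subset W] by [].
have tBxX : tight m ends Bx X.
  rewrite /tight !cinE (@card_diff_in _ Bx A) // => g.
  by rewrite eq_sym => /difx; rewrite subsetD => /andP[].
have tByX : tight m ends By Y.
  rewrite /tight !cinE (@card_diff_in _ By A) // => g.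
  by rewrite eq_sym => /dify; rewrite subsetD => /andP[].
have tBxY : tight m ends Bx Y.
  rewrite /tight; suff -> : inside ends Bx Y = inside ends A Y by [].
  apply/setP => g; rewrite !inE; case: (boolP (ends g \subset Y)) => gY; rewrite ?andbF //.
  by rewrite offx //; apply/negP => gX; apply: (dXY g).
have spC : sparse m ends C.
  exact: (sparse_replace ends2 spBx tBxY spBy tByX inY CY).
have difC g : (g \in A) != (g \in C) -> ends g \subset (X :|: Y) :\: S.
  case: (boolP (ends g \subset X)) => gX;
    [rewrite CX // => /difx | rewrite CnX // => /dify] => /subset_trans; apply.
    by rewrite setSD ?subsetUl.
  by rewrite setSD ?subsetUr.
have cC : #|C| = #|A|.
  rewrite -cBx -(cardsID (inside ends C Y)) -(cardsID (inside ends Bx Y) Bx).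
  have insI (D : {set E}) : D :&: inside ends D Y = inside ends D Y.
    by apply/setIidPr/subsetP => g; rewrite inE => /andP[].
  rewrite !insI; congr (_ + _).
    have -> : inside ends C Y = inside ends By Y.
      by apply/setP => g; rewrite !inE; case: (boolP (ends g \subset Y)) => gY;
        rewrite ?andbF // inY.
    by case/tightP: tBxY => _; case/tightP: tByX => _ <- /addIn.
  apply: eq_card => g; rewrite !inE.
  by case: (boolP (ends g \subset Y)) => gY; rewrite ?andbF ?andbT ?andNb //= CY.
have feasC : feasible C.
  split=> //.
  - apply/subsetP => g gF; case: (boolP (ends g \subset X)) => gX.
      by rewrite CX // (subsetP F0Bx).
    by rewrite CnX // (subsetP F0By).
  - apply/subsetP => g; rewrite inE => /andP[gF gC]; case: (boolP (ends g \subset X)) => gX.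
      by apply: (subsetP BxL); rewrite inE gF -CX.
    by apply: (subsetP ByL); rewrite inE gF -CnX.
  - move=> g g' v; rewrite !inE => /andP[gF gC] /andP[g'F g'C] vg vg'.
    case: (boolP (v \in X)) => vX'.
      have vY' : v \notin Y by move: (in_set0 v); rewrite -XY inE vX' /= => ->.
      by apply: (maBx g g' v); rewrite // inE ?gF ?g'F -?(vX g v) -?(vX g' v).
    by apply: (maBy g g' v); rewrite // inE ?gF ?g'F -?(vY g v) -?(vY g' v).
have inD g : g \notin F0 -> g \in C -> g \in C :\: F0 by move=> gF gC; rewrite inE gF.
have xY : x \notin Y by move: (in_set0 x); rewrite -XY inE xX /= => ->.
have yX : y \notin X by move: (in_set0 y); rewrite -XY inE yY andbT => ->.
have frCx : uncovered C x.
  move=> g; rewrite inE => /andP[gF gC]; apply/negP => xg.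
  by have /frx/negP[] : g \in Bx :\: F0 by rewrite inE gF -(vX g x).
have frCy : uncovered C y.
  move=> g; rewrite inE => /andP[gF gC]; apply/negP => yg.
  by have /fry/negP[] : g \in By :\: F0 by rewrite inE gF -(vY g y).
have eC : e \notin C by apply/negP => eC; case/negP: (frCx _ (inD _ eF eC)).
(* Otherwise [e |: C] would be feasible and larger than [A]. *)
have [W tW eW] : exists2 W, tight m ends C W & ends e \subset W.
  case: (boolP [exists W : {set V}, tight m ends C W && (ends e \subset W)]) => [/existsP[W
    /andP[]]|]; first by exists W.
  move=> /existsPn nW; have spU : sparse m ends (e |: C).
    by apply: sparse_add => // W tW; have := nW W; rewrite tW.
  have : feasible (e |: C).
    split=> //.
    - by apply: subset_trans (subsetUr _ _); case: feasC.
    - apply/subsetP => g; rewrite !inE => /andP[gF /orP[/eqP ->//|gC]].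
      by case: feasC => _ /subsetP CL _ _; apply: CL; rewrite inE gF.
    - have maE g v : g \in C :\: F0 -> v \in ends e -> v \notin ends g.
        by move=> gC; rewrite eE !inE => /orP[]/eqP->; [apply: frCx | apply: frCy].
      case: feasC => _ _ _ maC.
      move=> g g' v; rewrite !inE => /andP[gF /orP[/eqP->|gC]] /andP[g'F /orP[/eqP->|g'C]] // vg
        vg'.
      + by case/negP: (maE _ _ (inD _ g'F g'C) vg).
      + by case/negP: (maE _ _ (inD _ gF gC) vg').
      + by apply: (maC g g' v); rewrite ?inE ?gF ?g'F.
  by move=> /maxA; rewrite cardsU1 eC -cC ltnn.
have e0 : ends e != set0 by rewrite -cards_eq0 ends2.
(* Since [Z] is minimal, [e] may replace any edge of [C] inside [Z], which frees the ends of
   that edge; these ends are what leaves [S]. *)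
have [Z [tZ eZ minZ]] := tight_min spC tW eW e0.
have xZ : x \in Z by apply: (subsetP eZ).
have yZ : y \in Z by apply: (subsetP eZ).
(* Used twice: [S1 = S] would contradict the choice of [e] if nothing left [S], and [S1 = S'] gives
   the tight set for the vertices that do leave. *)
have tU S1 : S1 \subset S -> (forall g, g \in inside ends (C :\: F0) Z -> ends g \subset ~: S1) ->
    tight m ends (avoid A S1) (X :|: Y :|: Z).
  move=> S1S avZ; rewrite (@tight_avoid _ C) //; last first.
    by move=> g /difC /subset_trans; apply; rewrite setDSS ?subsetUl.
  have spS1 : sparse m ends (avoid C S1) by apply: sparse_sub spC; apply: avoid_sub.
  have sSS1 : avoid C S \subset avoid C S1 by apply: avoidS.
  have cI (D D' : {set E}) (U : {set V}) : (forall g, ends g \subset U -> (g \in D) = (g \in D')) ->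
      inside ends (avoid D S) U = inside ends (avoid D' S) U.
    move=> DD'; apply/setP => g; rewrite !inE.
    by case: (boolP (ends g \subset U)) => gU; rewrite ?andbF // DD'.
  have tX1 : tight m ends (avoid C S1) X.
    apply: sub_tight sSS1 _ _ => //; rewrite /tight (cI _ _ _ CX).
    by move: tX; rewrite (@tight_avoid A Bx).
  have tY1 : tight m ends (avoid C S1) Y.
    apply: sub_tight sSS1 _ _ => //; rewrite /tight (cI _ _ _ inY).
    by move: tY; rewrite (@tight_avoid A By).
  have tZ1 : tight m ends (avoid C S1) Z.
    rewrite /tight; suff -> : inside ends (avoid C S1) Z = inside ends C Z by [].
    apply/setP => g; rewrite !inE; case: (boolP (g \in C)) => //= gC.
    case: (boolP (ends g \subset Z)) => gZ; rewrite ?andbF ?andbT //.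
    by case: (boolP (g \in F0)) => //= gF; rewrite avZ // !inE gF gC.
  have -> : X :|: Y :|: Z = (X :|: Z) :|: (Y :|: Z) by rewrite setUACA setUid.
  apply: (tightU spS1).
  - by apply: (tightU spS1) => //; apply/set0Pn; exists x; rewrite !inE xX.
  - by apply: (tightU spS1) => //; apply/set0Pn; exists y; rewrite !inE yY.
  - by apply/set0Pn; exists x; rewrite !inE xX xZ !orbT.
pose S' := S :\: \bigcup_(g in inside ends (C :\: F0) Z) ends g.
have S'S : S' \subset S by apply: subsetDl.
have avS' g : g \in inside ends (C :\: F0) Z -> ends g \subset ~: S'.
  move=> gI; rewrite /S' setCD; apply: subset_trans (subsetUr _ _).
  exact: bigcup_sup.
exists S'; split.
- rewrite subsetD ZS; apply: bigcup_disjoint => g; rewrite inE disjoint_sym => /andP[gC _].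
  by apply: LZ0; case: feasC => _ /subsetP CL _ _; apply: CL.
- rewrite properE S'S; apply/negP => SS'.
  have := noT (X :|: Y :|: Z); rewrite tU //; first by rewrite (subset_trans eZ) // subsetUr.
  by move=> g /avS' /subset_trans; apply; rewrite setCS.
move=> v vS'; case: (boolP (v \in S)) => [vS|vS]; last first.
  have [U [B [vU tU' fB cB dB]]] := frS v vS; exists U, B; split=> //.
    by apply: sub_tight tU'; [apply: avoidS | apply: sparse_sub spA; apply: avoid_sub].
  by move=> g /dB /subset_trans; apply; apply: setDS.
move: vS'; rewrite inE vS andbT negbK => /bigcupP[g gI vg].
have /andP[/andP[gF gC] gZ] : (g \notin F0) && (g \in C) && (ends g \subset Z) by move: gI;
  rewrite !inE.
exists (X :|: Y :|: Z), (e |: C :\ g); split.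
- by rewrite inE (subsetP gZ) ?orbT.
- exact: tU.
- case: feasC => F0C CL _ maC; split.
  + apply/subsetP => h hF; rewrite !inE (subsetP F0C) // andbT orbC.
    by case: eqP => // hg; rewrite -hg hF in gF.
  + apply/subsetP => h; rewrite !inE => /andP[hF /orP[/eqP->//|/andP[_ hC]]].
    by apply: (subsetP CL); rewrite inE hF.
  + by apply: (@sparse_exchange _ _ _ _ _ Z) => //; rewrite inE gC.
  + have maE h w : h \in C :\: F0 -> w \in ends e -> w \notin ends h.
      by move=> hC; rewrite eE !inE => /orP[]/eqP->; [apply: frCx | apply: frCy].
    move=> h h' w; rewrite !inE => /andP[hF /orP[/eqP->|/andP[_ hC]]] /andP[h'F
      /orP[/eqP->|/andP[_ h'C]]] // wh wh'.
    * by case/negP: (maE _ _ (inD _ h'F h'C) wh).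
    * by case/negP: (maE _ _ (inD _ hF hC) wh').
    * by apply: (maC h h' w); rewrite ?inE ?hF ?h'F.
- split; first by rewrite cardsU1 !inE negb_and eC orbT /= -cC (cardsD1 g C) gC.
  move=> h; rewrite !inE => /andP[hF /orP[/eqP->|/andP[hg hC]]].
    apply/negP; rewrite eE !inE => /orP[]/eqP vE.
      by case/negP: (frCx _ (inD _ gF gC)); rewrite -vE.
    by case/negP: (frCy _ (inD _ gF gC)); rewrite -vE.
  apply/negP => vh; case: feasC => _ _ _ maC; case/negP: hg; apply/eqP.
  by apply: (maC h g v); rewrite ?inE ?hF ?gF.
- move=> h; rewrite !inE subsetD => hd.
  case: (eqVneq h e) hd => [->|he] /=.
    rewrite (subset_trans eZ) ?subsetUr //= => _.
    by rewrite disjoints_subset (subset_trans eS) // setCS.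
  case: (eqVneq h g) => [->|hg] /= hd.
    by rewrite (subset_trans gZ) ?subsetUr //= disjoints_subset avS'.
  have := difC h hd; rewrite subsetD => /andP[h1 h2]; rewrite (subset_trans h1) ?subsetUl //=.
  by move: h2; rewrite !disjoints_subset => /subset_trans; apply; rewrite setCS.
Qed.

(** Start from [Z0] and all covered vertices: a vertex outside is unmatched already, hence freeable
    through its singleton. Then shrink by [win_step] as long as it applies. *)
Lemma win_closed A : feasible A -> (forall B, feasible B -> #|B| <= #|A|) ->
  exists S, [/\ Z0 \subset S, S \subset Z0 :|: \bigcup_(e in A :\: F0) ends e & spanned_off A S].
Proof.
move=> fA maxA; pose S0 := Z0 :|: \bigcup_(e in A :\: F0) ends e.
have: Z0 \subset S0 by apply: subsetUl.
have: S0 \subset S0 by [].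
have: freeable A S0.
  move=> v; rewrite inE negb_or => /andP[_ vc]; exists [set v], A.
  split; [by rewrite inE | exact: tight1 | by [] | split=> // e eA | by move=> e; rewrite eqxx].
  by apply: contraNN vc => ve; apply/bigcupP; exists e.
(* The occurrence left in place keeps the initial set as an upper bound. *)
move: {1 2 4}S0 => S; have [n] := ubnP #|S|; elim: n S => // n IH S Sn frS SS0 ZS.
case: (boolP (spanned_off A S)) => [clS|nclS]; first by exists S.
have [S' [ZS' S'S frS']] := win_step fA maxA ZS frS nclS.
apply: (IH S') => //; first by apply: leq_trans (proper_card S'S) _.
by apply: subset_trans SS0; apply: proper_sub.
Qed.

End Exchange.

(** * Orientations and disjoint arborescences *)

Section Orientation.
Variables (V E : finType) (ends : E -> {set V}).
Hypothesis ends2 : forall e, #|ends e| = 2.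
Implicit Types (A : {set E}) (X Y : {set V}) (h : E -> V).

(** Hakimi's criterion, with [h e] the head of [e]. An edge can be headed at its end [x], using one
    unit of [cap x], unless a saturated set contains [x] but not the whole edge. If both ends are
    blocked, uncrossing the two saturated sets makes their union, which contains the edge,
    overfull. *)
Lemma orientation A (cap : V -> nat) :
  (forall X, #|inside ends A X| <= \sum_(v in X) cap v) ->
  exists2 h, forall e, h e \in ends e & forall v, #|[set e in A | h e == v]| <= cap v.
Proof.
have [n] := ubnP #|A|; elim: n A cap => // n IH A cap An capA.
have [->|[e eA]] := set_0Vmem A.
  have h e : {v | v \in ends e} by apply: sigW; apply/set0Pn; rewrite -cards_eq0 ends2.
  exists (fun e => sval (h e)) => [e|v]; first exact: svalP (h e).
  by rewrite (_ : [set _ in _ | _] = set0) ?cards0 //; apply/setP => e; rewrite !inE.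
have An' : #|A :\ e| < n by move: An; rewrite (cardsD1 e) eA.
have ok x : x \in ends e ->
    (forall X, x \in X -> ~~ (ends e \subset X) -> #|inside ends A X| < \sum_(v in X) cap v) ->
    exists2 h, forall e, h e \in ends e & forall v, #|[set e in A | h e == v]| <= cap v.
  move=> xe capx; pose cap' v := cap v - (v == x).
  have x1 : 0 < cap x.
    have := capx [set x]; rewrite inE big_set1 => /(_ (eqxx x)) H; apply: leq_ltn_trans (H _) => //.
    by apply/negP => /subset_leq_card; rewrite ends2 cards1.
  have scap (X : {set V}) : \sum_(v in X) cap v = (x \in X) + \sum_(v in X) cap' v.
    case: (boolP (x \in X)) => xX.
      rewrite (bigD1 x) //= [in RHS](bigD1 x) //= addnA /cap' eqxx subn1 add1n prednK //.
      by congr (_ + _); apply: eq_bigr => v /andP[_ /negbTE ->]; rewrite subn0.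
    by apply: eq_bigr => v vX; rewrite /cap'; case: eqP => [vx|_]; rewrite ?subn0 //;
      case/negP: xX; rewrite -vx.
  have [X|h hE hcap] := IH (A :\ e) cap' An'.
    rewrite -(leq_add2l (x \in X)) -scap; have := capA X; have := capx X.
    rewrite (card_insideD1 ends X eA); case: (boolP (ends e \subset X)) => eX.
      by rewrite (subsetP eX).
    by case: (x \in X) => //= + _; apply.
  exists (fun g => if g == e then x else h g) => [g|v]; first by case: eqP => [->|].
  have -> : cap v = (v == x) + cap' v by rewrite /cap'; case: eqP => [->|];
    rewrite ?subn0 // subnKC.
  apply: leq_trans (leq_add (leqnn _) (hcap v)).
  have : [set g in A | (if g == e then x else h g) == v]
      \subset (if v == x then [set e] else set0) :|: [set g in A :\ e | h g == v].
    apply/subsetP => g; rewrite !inE; case: (eqVneq g e) => [-> /andP[_ /eqP->]|_ /= ->].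
      by rewrite eqxx inE eqxx.
    by rewrite orbT.
  move/subset_leq_card/leq_trans; apply; apply: leq_trans (leq_card_setU _ _) _.
  by rewrite leq_add2r; case: eqP; rewrite ?cards1 ?cards0.
have /eqP/cards2P[x [y [xy eE]]] := ends2 e.
have xe : x \in ends e by rewrite eE !inE eqxx.
have ye : y \in ends e by rewrite eE !inE eqxx orbT.
pose bad z (X : {set V}) := [&& z \in X, ~~ (ends e \subset X) & \sum_(v in X) cap v <= #|inside
  ends A X|].
have okb z : z \in ends e -> ~~ [exists X, bad z X] ->
    exists2 h, forall e, h e \in ends e & forall v, #|[set e in A | h e == v]| <= cap v.
  move=> ze /existsPn nb; apply: (ok z ze) => X zX eX; have := nb X.
  by rewrite /bad zX eX -ltnNge.
case: (boolP [exists X, bad x X]) => [/existsP[X /and3P[xX eX tX]]|]; last exact: okb.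
case: (boolP [exists X, bad y X]) => [/existsP[Y /and3P[yY eY tY]]|]; last exact: okb.
have eU : ends e \subset X :|: Y by rewrite eE subUset !sub1set !inE xX yY orbT.
have eI : ~~ (ends e \subset X :&: Y) by rewrite subsetI negb_and eX.
have := inside_supermod ends (A :\ e) X Y.
have := capA (X :|: Y); have := capA (X :&: Y).
move: tX tY; rewrite !(card_insideD1 ends _ eA) eU (negbTE eX) (negbTE eY) (negbTE eI).
have : \sum_(v in X :|: Y) cap v + \sum_(v in X :&: Y) cap v = \sum_(v in X) cap v + \sum_(v in
  Y) cap v.
  rewrite (big_setID X) /= setUK setDUl setDv set0U [in RHS](big_setID (A := Y) X) /= (setIC Y).
  by rewrite -addnA; congr (_ + _); rewrite addnC.
by rewrite !add0n add1n; lia.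
Qed.

End Orientation.

Section Branching.
Variables (V E : finType) (ends : E -> {set V}).
Hypothesis ends2 : forall e, #|ends e| = 2.
Variable h : E -> V.
Hypothesis hE : forall e, h e \in ends e.
Variable s : V.
Implicit Types (A T : {set E}) (X Y U : {set V}).

Definition link A : rel V := [rel x y | [exists e in A, ends e == [set x; y]]].

(** [h] gives each edge a head; this is the in-degree of [X] in the resulting digraph. *)
Definition indeg A X : nat := #|[set e in A | (h e \in X) && ~~ (ends e \subset X)]|.

Lemma indegE A X : #|[set e in A | h e \in X]| = indeg A X + #|inside ends A X|.
Proof.
rewrite -(cardsID (inside ends A X)) addnC; congr (_ + _).
  by apply: eq_card => e; rewrite !inE; case: (e \in A); rewrite //= andbC.
apply: eq_card => e; rewrite !inE; case: (e \in A) => //=.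
by apply: andb_idl => /subsetP; apply.
Qed.

(** The in-degree is a modular count, of heads in [X], minus a supermodular one, of edges inside
    [X]. *)
Lemma indeg_submod A X Y : indeg A (X :&: Y) + indeg A (X :|: Y) <= indeg A X + indeg A Y.
Proof.
have := inside_supermod ends A X Y.
have := cardsUI [set e in A | h e \in X] [set e in A | h e \in Y].
have -> : [set e in A | h e \in X] :|: [set e in A | h e \in Y] = [set e in A | h e \in X :|: Y].
  by apply/setP => e; rewrite !inE; case: (e \in A).
have -> : [set e in A | h e \in X] :&: [set e in A | h e \in Y] = [set e in A | h e \in X :&: Y].
  by apply/setP => e; rewrite !inE; case: (e \in A).
by rewrite !indegE; lia.
Qed.

Lemma link_sym A : symmetric (link A).
Proof. by move=> x y; apply: eq_existsb => e; rewrite setUC. Qed.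

Lemma link_sub A A' x y : A \subset A' -> connect (link A) x y -> connect (link A') x y.
Proof.
move=> AA'; apply: connect_sub => u v /existsP[e /andP[eA eE]]; apply: connect1.
by apply/existsP; exists e; rewrite (subsetP AA').
Qed.

Lemma link1 A e x y : e \in A -> x \in ends e -> y \in ends e -> connect (link A) x y.
Proof.
move=> eA; have /eqP/cards2P[u [v [uv eE]]] := ends2 e.
have uv1 : connect (link A) u v by apply/connect1/existsP; exists e; rewrite eA eE /=.
have vu1 : connect (link A) v u by apply/connect1/existsP; exists e; rewrite eA eE setUC /=.
by rewrite eE !inE => /orP[]/eqP-> /orP[]/eqP->; rewrite ?connect0.
Qed.

(* Lovasz's proof of Edmonds' branching theorem: a partial arborescence [T] on [U] is grown
   from the root through an edge leaving [U] inside a minimal critical set. *)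
Lemma arborescence A k :
  (forall X, s \notin X -> X != set0 -> k < indeg A X) ->
  exists T, [/\ T \subset A, forall v, connect (link T) s v &
    forall X, s \notin X -> X != set0 -> k <= indeg (A :\: T) X].
Proof.
move=> cutA.
pose inv (U : {set V}) T := [/\ T \subset A, s \in U, {in U, forall v, connect (link T) s v},
  forall e, e \in T -> ends e \subset U &
  forall X, s \notin X -> X != set0 -> k <= indeg (A :\: T) X].
suff [T [TA _ conT _ cutT]] : exists T, inv setT T by exists T; split=> // v; apply: conT.
have : inv [set s] set0.
  split; [exact: sub0set | by rewrite inE | by move=> v /set1P -> | by move=> e; rewrite inE | ].
  by move=> X sX X0; rewrite setD0 ltnW ?cutA.
move: [set s] set0 => U T; have [n] := ubnP #|~: U|; elim: n U T => // n IH U T Un.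
move=> [TA sU conT TU cutT]; case: (eqVneq U setT) => [UT|nUT]; first by exists T; rewrite -UT.
have out (X : {set V}) : [disjoint X & U] -> indeg (A :\: T) X = indeg A X.
  move=> XU; apply: eq_card => e; rewrite !inE.
  case: (boolP (e \in T)) => //= eT; case: (boolP (h e \in X)) => //= hX; rewrite ?andbF //.
  by have := disjointFr XU hX; rewrite (subsetP (TU e eT)).
pose crit X := [&& s \notin X, ~~ (X \subset U) & indeg (A :\: T) X == k].
have [e [eA eT hU /subsetPn[u ue uU]] ecrit] : exists2 e,
    [/\ e \in A, e \notin T, h e \notin U & ~~ (ends e \subset ~: U)]
  & forall X, crit X -> h e \in X -> ends e \subset X.
  case: (boolP [exists X, crit X]) => [/existsP[X0 cX0]|/existsPn nc].
    case: (@arg_minnP _ X0 crit (fun X => #|X|) cX0) => X /and3P[sX XU /eqP kX] minX.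
    (* Edges of [T] stay inside [U], so [X :\: U] keeps its full in-degree, above that of the
       critical [X]. Hence some edge enters [X :\: U] without entering [X]: it comes from
       [X :&: U]. *)
    have : indeg (A :\: T) X < indeg (A :\: T) (X :\: U).
      rewrite kX out; last by rewrite disjoint_sym disjoints_subset; apply/subsetP => v;
        rewrite !inE => ->.
      by apply: cutA; rewrite ?inE ?(negbTE sX) ?andbF // setD_eq0.
    rewrite ltnNge => H; have /subsetPn[e] : ~~ ([set e in A :\: T | (h e \in X :\: U) && ~~
      (ends e \subset X :\: U)] \subset
       [set e in A :\: T | (h e \in X) && ~~ (ends e \subset X)]) by apply: contraNN H;
         apply: subset_leq_card.
    rewrite !inE => /andP[/andP[eT eA] /andP[/andP[hU hX] eXU]]; rewrite eT eA hX /= negbK => eX.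
    have eU : ~~ (ends e \subset ~: U) by move: eXU; rewrite setDE subsetI eX.
    exists e; first by split.
    move=> Y cY hY; case: (boolP (ends e \subset Y)) => // eY.
    have /and3P[sY YU /eqP kY] := cY.
    (* If [Y] did not contain [e], submodularity would make [X :&: Y] a smaller critical set. *)
    have nI : ~~ (X :&: Y \subset U) by apply/subsetPn; exists (h e); rewrite ?inE ?hX.
    have cI : crit (X :&: Y).
      rewrite /crit inE (negbTE sX) nI /=.
      have := indeg_submod (A :\: T) X Y; rewrite kX kY.
      have : k <= indeg (A :\: T) (X :&: Y).
        apply: cutT; first by rewrite inE (negbTE sX).
        by apply: contraNneq nI => ->; apply: sub0set.
      have : k <= indeg (A :\: T) (X :|: Y).
        apply: cutT; first by rewrite inE negb_or sX.
        by apply/set0Pn; exists (h e); rewrite inE hX.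
      move=> kU kI kXY; rewrite eqn_leq kI andbT -(leq_add2r k).
      by apply: leq_trans kXY; rewrite leq_add2l.
    have := minX _ cI; rewrite leqNgt => /negP[]; apply: proper_card.
    by rewrite properE subsetIl subsetI subxx /=; apply: contraNN eY; apply: subset_trans.
  have : 0 < indeg (A :\: T) (~: U).
    rewrite out; last by rewrite disjoints_subset.
    apply: leq_ltn_trans (cutA _ _ _); rewrite ?inE ?sU //.
    by apply: contraNneq nUT => /(congr1 (@setC _)); rewrite setCK setC0 => ->.
  rewrite card_gt0 => /set0Pn[e]; rewrite !inE => /andP[/andP[eT eA] /andP[hU eU]].
  by exists e => // X cX; have := nc X; rewrite cX.
move: uU; rewrite inE negbK => uU.
have endsE v : v \in ends e -> (v == u) || (v == h e).
  have hu : u != h e by apply: contraNneq hU => <-.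
  have : ends e == [set u; h e].
    by rewrite eq_sym eqEcard ends2 cards2 hu subUset !sub1set ue hE.
  by move=> /eqP ->; rewrite !inE.
apply: (IH (h e |: U) (e |: T)).
  rewrite -ltnS; apply: leq_trans Un; rewrite ltnS; apply: proper_card;
    rewrite properE setCS subsetUr /=.
  by apply/subsetPn; exists (h e); rewrite !inE ?eqxx.
split.
- by rewrite subUset sub1set eA.
- by rewrite inE sU orbT.
- have cU v : v \in U -> connect (link (e |: T)) s v by move=> /conT; apply/link_sub/subsetUr.
  move=> v; rewrite !inE => /orP[/eqP->|]; last exact: cU.
  by apply: connect_trans (cU u uU) _; apply: (@link1 _ e); rewrite ?inE ?eqxx.
- move=> g; rewrite !inE => /orP[/eqP->|/TU /subset_trans]; last by apply; apply: subsetUr.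
  by apply/subsetP => v /endsE /orP[]/eqP->; rewrite !inE ?eqxx ?uU ?orbT.
(* If [e] enters [X], then [X] was not critical by the choice of [e], so it can spare one unit of
   in-degree. *)
- move=> X sX X0; case: (boolP ((h e \in X) && ~~ (ends e \subset X))) => [/andP[hX eX]|neX].
    have : k < indeg (A :\: T) X.
      rewrite ltn_neqAle cutT // andbT; apply: contraNneq eX => kX.
      by apply: ecrit => //; rewrite /crit sX -kX eqxx andbT; apply/subsetPn; exists (h e).
    rewrite /indeg (cardsD1 e) => /leq_trans H; rewrite -ltnS.
    apply: leq_trans (H _ (leqnn _)) _; rewrite -add1n leq_add ?leq_b1 // subset_leq_card //.
    by apply/subsetP => g; rewrite !inE negb_or => /andP[-> /andP[/andP[-> ->] ->]].
  apply: leq_trans (cutT X sX X0) _; rewrite subset_leq_card //; apply/subsetP => g.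
  rewrite !inE => /andP[/andP[gT gA] gX]; rewrite negb_or gT gA gX /= !andbT.
  by apply: contraNneq neX => <-.
Qed.

Lemma arborescences A k :
  (forall X, s \notin X -> X != set0 -> k <= indeg A X) ->
  exists T : 'I_k -> {set E}, [/\ forall i, T i \subset A,
    forall i j, i != j -> [disjoint T i & T j] & forall i v, connect (link (T i)) s v].
Proof.
elim: k A => [|k IH] A cutA; first by exists (fun=> set0); split; case.
have [T0 [T0A conT0 cutT0]] := arborescence cutA.
have [T [TA disT conT]] := IH _ cutT0.
exists (fun i => if unlift ord0 i is Some j then T j else T0); split.
- by move=> i; case: unliftP => // j _; apply: subset_trans (TA j) (subsetDl _ _).
- have dis0 j : [disjoint T0 & T j].
    by rewrite disjoint_sym; have := TA j; rewrite subsetD => /andP[].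
  move=> i j; case: unliftP => [i' ->|->]; case: unliftP => [j' ->|->]; rewrite ?eqxx //.
  + by move=> ij; apply: disT; apply: contraNneq ij => ->.
  + by rewrite disjoint_sym.
- by move=> i v; case: unliftP.
Qed.

End Branching.

(** * Packing spanning trees *)

Lemma adjE (G : mgraph) (F : {set edge G}) : adj F [set: G] =2 link (@ends G) F.
Proof. by move=> x y; rewrite /adj /= !in_setT. Qed.

Lemma cycle_bypass (G : mgraph) (T : {set edge G}) k (v : 'I_k.+1 -> G) (e : 'I_k.+1 -> edge G) :
  is_cycle T v e ->
  connect (link (@ends G) (T :\ e ord0)) (v (ordS ord0)) (v ord0).
Proof.
move=> [_ vI eI eT]; have e2 := @endsP G.
case: k v e vI eI eT => [|k] v e vI eI eT.
  by rewrite (_ : ordS ord0 = ord0) ?connect0 //; apply/val_inj.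
have step j : j != ord0 -> connect (link (@ends G) (T :\ e ord0)) (v j) (v (ordS j)).
  move=> j0; have [ejT ejE] := eT j.
  apply: (link1 e2 (e := e j)); rewrite ?ejE ?inE ?eqxx ?orbT //.
  by rewrite ejT andbT (inj_eq eI).
have reach n (nk : n.+1 < k.+2) :
    connect (link (@ends G) (T :\ e ord0)) (v (ordS ord0)) (v (Ordinal nk)).
  elim: n nk => [|n IH] nk; first by rewrite (_ : Ordinal nk = ordS ord0) ?connect0 //;
    apply/val_inj.
  apply: connect_trans (IH (ltnW nk)) _.
  rewrite (_ : Ordinal nk = ordS (Ordinal (ltnW nk))); first exact: step.
  by apply/val_inj; rewrite /= modn_small.
apply: connect_trans (reach k (ltnSn _)) _.
have last : ordS (Ordinal (ltnSn k.+1)) = ord0 by apply/val_inj; rewrite /= modnn.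
by have := step (Ordinal (ltnSn k.+1)); rewrite last; apply.
Qed.

(** A minimal connected edge set has no cycle, since a cycle edge is bypassed by the rest of its
    cycle. *)
Lemma spanning_tree_exists (G : mgraph) (F : {set edge G}) : connectedg F ->
  exists2 T : {set edge G}, T \subset F & spanning_tree T.
Proof.
move=> conF; pose P (T : {set edge G}) := [forall x, forall y, connect (adj T [set: G]) x y].
have PP T : reflect (connectedg T) (P T).
  by apply: (iffP forallP) => H x; [move=> y; have /forallP := H x; apply | apply/forallP/H].
have [T /minsetP[/PP conT minT] TF] := minset_exists (introT (PP F) conF).
exists T => //; split=> // -[|k] v e cyc; first by case: cyc.
have eT : e ord0 \in T by case: cyc => _ _ _ /(_ ord0)[].
have sym : connect_sym (link (@ends G) (T :\ e ord0)) by apply/sym_connect_sym/link_sym.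
suff /minT : P (T :\ e ord0).
  by move=> /(_ (subsetDl _ _)) /setP/(_ (e ord0)); rewrite !inE eqxx eT.
apply/PP => x y; rewrite (eq_connect (adjE _)).
have := conT x y; rewrite (eq_connect (adjE _)); apply: connect_sub => {}x {}y.
move=> /existsP[g /andP[gT /eqP gE]].
case: (eqVneq g (e ord0)) => [ge|ge].
  have byp := cycle_bypass cyc; have byp' := byp; rewrite sym in byp'.
  case: cyc => _ _ _ /(_ ord0)[_]; rewrite -ge gE => eE.
  have xe : x \in [set x; y] by rewrite !inE eqxx.
  have ye : y \in [set x; y] by rewrite !inE eqxx orbT.
  by move: xe ye; rewrite eE !inE => /orP[]/eqP-> /orP[]/eqP->; rewrite ?connect0 ?ge.
by apply/connect1/existsP; exists g; rewrite !inE ge gT gE /=.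
Qed.

Lemma sparse_tree_connected (G : mgraph) m (A F : {set edge G}) : A \subset F ->
  sparse m (@ends G) A -> tight m (@ends G) A [set: G] -> tree_connected m F.
Proof.
move=> AF spA /tightP[/set0Pn[s _] tA]; have e2 := @endsP G.
have inT : inside (@ends G) A [set: G] = A by apply/setP => e; rewrite !inE subsetT andbT.
(* With capacity [0] at the root and [m] elsewhere, the orientation condition follows from
   sparsity. *)
have capP X : #|inside (@ends G) A X| <= \sum_(v in X) (if v == s then 0 else m).
  have [->|X0] := eqVneq X set0.
    rewrite big_set0 leqn0 cards_eq0; apply/eqP/setP => e; rewrite !inE subset0 -cards_eq0 e2.
    by rewrite andbF.
  have := elimT (sparseP _ _ _) spA X X0.
  have : m * #|X| <= m + \sum_(v in X) (if v == s then 0 else m).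
    case: (boolP (s \in X)) => sX.
      rewrite (bigD1 s) //= eqxx add0n (cardsD1 s) sX mulnDr muln1 leq_add2l.
      rewrite mulnC -sum_nat_const (eq_bigl (fun v => (v \in X) && (v != s))); last by move=> v;
        rewrite !inE andbC.
      by apply: leq_sum => v /andP[_ /negbTE->].
    rewrite mulnC -sum_nat_const; apply: leq_trans (leq_addl _ _); apply: leq_sum => v vX.
    by case: eqP => // vs; rewrite -vs vX in sX.
  lia.
have [h hE hcap] := orientation e2 capP.
have sum_h X : #|[set e in A | h e \in X]| = \sum_(v in X) #|[set e in A | h e == v]|.
  rewrite -sum1_card (partition_big h (mem X)) /=; last by move=> e; rewrite inE => /andP[].
  apply: eq_bigr => v vX; rewrite -sum1_card; apply: eq_bigl => e; rewrite !inE.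
  by case: eqP => [->|]; rewrite ?andbF // vX !andbT.
(* The capacities add up to [m * (#|G| - 1)], the number of edges of [A], so every bound is
   attained. *)
have hdeg v : v != s -> #|[set e in A | h e == v]| = m.
  move=> vs; apply/eqP; rewrite eqn_leq; have := hcap v; rewrite (negbTE vs) => -> /=.
  rewrite leqNgt; apply/negP => lt_m.
  have : #|A| < \sum_(u : G) (if u == s then 0 else m).
    have -> : #|A| = \sum_(u in [set: G]) #|[set e in A | h e == u]|.
      by rewrite -sum_h; apply: eq_card => e; rewrite !inE andbT.
    rewrite (eq_bigl predT) => [|u]; last by rewrite inE.
    rewrite (bigD1 v) //= [X in _ < X](bigD1 v) //= (negbTE vs) -addSn leq_add //.
    by apply: leq_sum => u _.
  rewrite (bigD1 s) //= eqxx add0n (eq_bigr (fun=> m)) => [|u /negbTE-> //].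
  rewrite (eq_bigl [in predC1 s]) // sum_nat_const cardC1.
  move: tA; rewrite inT cardsT; have : 0 < #|G| by apply/card_gt0P; exists s.
  nia.
(* A nonempty [X] without the root has [m * #|X|] heads, and by sparsity at least [m] of these edges
   do not lie inside [X]. *)
have [X sX X0|T [TA disT conT]] := arborescences e2 hE (s := s) (A := A) (k := m).
  have := elimT (sparseP _ _ _) spA X X0; rewrite addnC => spX.
  rewrite -(leq_add2r #|inside (@ends G) A X|) -indegE // sum_h.
  rewrite (eq_bigr (fun=> m)) => [|v vX]; last by apply: hdeg; apply: contraNneq sX => <-.
  by rewrite sum_nat_const mulnC.
have conT' i : connectedg (T i).
  move=> x y; rewrite (eq_connect (adjE _)); apply: connect_trans (conT i y).
  by rewrite sym_connect_sym ?conT //; apply: link_sym.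
have [S S_] : exists S : 'I_m -> {set edge G}, forall i, (S i \subset T i) /\ spanning_tree (S i).
  have /fin_all_exists[S S_] i : exists S : {set edge G}, (S \subset T i) /\ spanning_tree S.
    by have [S] := spanning_tree_exists (conT' i); exists S.
  by exists S.
exists S; split=> [i|i j ij|i]; last by case: (S_ i).
  by apply: subset_trans AF; apply: subset_trans (TA i); case: (S_ i).
have [Si _] := S_ i; have [Sj _] := S_ j.
by apply: disjointWl Si _; apply: disjointWr Sj _; apply: disT.
Qed.

(** * Toughness and labels *)

(** A labelling constant along the edges of [G - S] is constant on components, so it uses at most
    [omega S] labels. Toughness enters the proof only through this bound. *)
Lemma tough_label (R : realFieldType) (G : mgraph) (t : nat) (L : finType)
    (S : {set G}) (g : G -> L) :
  0 < t -> tough (t%:R%R : R) G ->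
  (forall (e : edge G) x y, x \in ends e -> y \in ends e -> x \notin S -> y \notin S -> g x = g
    y) ->
  #|g @: (~: S)| <= 1 \/ t * #|g @: (~: S)| <= #|S|.
Proof.
move=> t0 tG gS; pose a := adj [set: edge G] (~: S).
have asym : symmetric a.
  by move=> x y; rewrite /a /adj /= andbCA; do 2 congr andb; apply: eq_existsb => e; rewrite setUC.
have ag x y : a x y -> g x = g y.
  case/and3P; rewrite !inE => xS yS /existsP[e /andP[_ /eqP eE]].
  by apply: (gS e); rewrite // eE !inE eqxx ?orbT.
have acl : closed a (mem (~: S)).
  by move=> x y /and3P[xS yS _]; rewrite !inE in xS yS *; rewrite xS yS.
have cg x y : connect a x y -> g x = g y.
  move=> /connectP[p + ->]; elim: p x => //= z p IH x /andP[/ag -> /IH]; exact.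
have le_om : #|g @: (~: S)| <= omega S.
  suff : g @: (~: S) \subset g @: [set x | roots a x && (x \in ~: S)].
    move=> /subset_leq_card/leq_trans; apply; apply: leq_trans (leq_imset_card g _) _.
    rewrite /omega /n_comp_mem; apply/eq_leq/eq_card => x; rewrite !inE //.
  apply/subsetP => _ /imsetP[x xS ->]; rewrite (cg x (fingraph.root a x)) ?connect_root //.
  rewrite imset_f // inE (fingraph.roots_root (sym_connect_sym asym)) /=.
  by rewrite -(closed_connect acl (connect_root a x)).
have := tG S; rewrite le_max => /orP[].
  by rewrite -[X in (_ <= X)%R]/(1%:R)%R ler_nat => om1; left; apply: leq_trans om1.
rewrite ler_pdivlMl ?ltr0n // -natrM ler_nat => omS.
by right; apply: leq_trans omS; rewrite leq_mul2l le_om orbT.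
Qed.

Lemma sum_incidence (V E : finType) (ends : E -> {set V}) (B : {set E}) (U : {set V}) :
  \sum_(e in B) #|ends e :&: U| = \sum_(v in U) #|[set e in B | v \in ends e]|.
Proof.
rewrite (eq_bigr (fun e => \sum_(v in U) (v \in ends e))); last first.
  move=> e _; rewrite -sum1_card [RHS]big_mkcond [LHS]big_mkcond; apply: eq_bigr => v _.
  by rewrite inE; do 2 case: (v \in _).
rewrite exchange_big; apply: eq_bigr => v _; rewrite -sum1_card [RHS]big_mkcond [LHS]big_mkcond.
by apply: eq_bigr => e _; rewrite inE; case: (e \in B); case: (v \in _).
Qed.

(** * Counting the tight parts *)

Section Parts.
Variables (V E : finType) (m : nat) (ends : E -> {set V}).
Hypothesis ends2 : forall e, #|ends e| = 2.
Variables (K : {set E}).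
Hypothesis spK : sparse m ends K.
Implicit Types (X Y : {set V}) (T : {set {set V}}).

(** Tight sets through [x] are closed under union, so one of maximum size is the greatest, and the
    parts partition the vertices. The default [[set x]] is tight. *)
Definition part (x : V) : {set V} :=
  [arg max_(X > [set x] | tight m ends K X && (x \in X)) #|X|].

Lemma partP x : [/\ x \in part x, tight m ends K (part x) &
  forall Y, tight m ends K Y -> x \in Y -> Y \subset part x].
Proof.
rewrite /part; case: arg_maxnP => [|X /andP[tX xX] maxX].
  by rewrite tight1 // inE eqxx.
split=> // Y tY xY; have xXY : X :&: Y != set0 by apply/set0Pn; exists x; rewrite inE xX.
have := maxX (X :|: Y); rewrite (tightU spK) // inE xX => /(_ isT) le.
by apply/setUidPl/eqP; rewrite eq_sym eqEcard subsetUl.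
Qed.

Lemma mem_part x : x \in part x. Proof. by case: (partP x). Qed.

Lemma tight_part x : tight m ends K (part x). Proof. by case: (partP x). Qed.

Lemma tight_sub_part x Y : tight m ends K Y -> x \in Y -> Y \subset part x.
Proof. by move=> tY xY; case: (partP x) => _ _; apply. Qed.

Lemma part_eq x y : y \in part x -> part y = part x.
Proof.
move=> yx; have xy := tight_sub_part (tight_part x) yx.
apply/eqP; rewrite eqEsubset xy andbT; apply: tight_sub_part (tight_part y) _.
by rewrite (subsetP xy) ?mem_part.
Qed.

Definition parts : {set {set V}} := [set part x | x in V].

Lemma mem_partsP X : reflect (exists2 x, x \in X & part x = X) (X \in parts).
Proof.
apply: (iffP imsetP) => [[x _ ->]|[x xX <-]]; exists x => //.
  exact: mem_part.
Qed.

Lemma part_in X x : X \in parts -> (part x == X) = (x \in X).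
Proof.
case/mem_partsP => y yX <-; apply/eqP/idP => [<-|]; [exact: mem_part | exact: part_eq].
Qed.

Definition covered_by T : {set V} := [set v | part v \in T].

Lemma card_covered_by T : T \subset parts -> #|covered_by T| = \sum_(X in T) #|X|.
Proof.
move=> TP; rewrite -sum1_card (partition_big part (mem T)) /=; last by move=> v; rewrite inE.
apply: eq_bigr => X XT; rewrite -sum1_card; apply: eq_bigl => v.
by rewrite inE part_in ?(subsetP TP) // andb_idl // => vX; have := part_in v (subsetP TP X XT);
  rewrite vX => /eqP ->.
Qed.

Variable tail : E -> V.
Hypothesis tailE : forall e, tail e \in ends e.

(** Lying inside a part can be tested at either end, so [tail] may be any choice of an end. *)
Definition inner e := ends e \subset part (tail e).

Lemma innerP e v : v \in ends e -> inner e = (ends e \subset part v).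
Proof.
move=> ve; apply/idP/idP => H; have vt := subsetP H.
  by rewrite (part_eq (vt v ve)).
by rewrite /inner (part_eq (vt _ (tailE e))).
Qed.

Lemma inner_tight e Y : tight m ends K Y -> ends e \subset Y -> inner e.
Proof.
move=> tY eY; apply: (subset_trans eY); apply: (tight_sub_part tY).
exact: (subsetP eY).
Qed.

(** The tightness equations of the parts in [T] are added up; parts are disjoint, so an inner edge
    is counted for one part only. *)
Lemma card_inner T : T \subset parts ->
  #|[set e in K | inner e && (part (tail e) \in T)]| + m * #|T| = m * #|covered_by T|.
Proof.
move=> TP; rewrite card_covered_by // big_distrr /=.
have -> : #|[set e in K | inner e && (part (tail e) \in T)]| = \sum_(X in T) #|inside ends K X|.
  rewrite -sum1_card (partition_big (fun e => part (tail e)) (mem T)) /=; last first.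
    by move=> e; rewrite inE => /and3P[].
  apply: eq_bigr => X XT; rewrite -sum1_card; apply: eq_bigl => e; rewrite !inE -!andbA; congr andb.
  have XP := subsetP TP X XT.
  apply/and3P/idP => [[eI _ /eqP <-]|eX]; first by [].
  have tX : part (tail e) = X by apply/eqP; rewrite part_in // (subsetP eX).
  by rewrite /inner tX eX XT.
rewrite mulnC -sum_nat_const -big_split /=; apply: eq_bigr => X XT.
by have /mem_partsP[x _ <-] := subsetP TP X XT; have /tightP[_] := tight_part x.
Qed.

End Parts.

(* Here [a = 2m]; [L] and [ps] count the large and small parts, [q] the large parts contained in
   the cut, [c] the crossing edges, [y] and [x] those with some end, resp. both ends, in large
   parts; [C] and [e] count the matching edges meeting [S], resp. inside [S]; [s = |S|],
   [z = |Z0|], [t] counts the parts meeting [S], [r] the labels outside the cut, and [d] is the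
   size of the cut. *)
Lemma toughness_contradiction (a b2 L q ps y x C e s z t c r d : nat) :
  0 < a -> 2 * c + 2 * C + a + 2 <= a * (L + ps) -> a * ps + y + x <= 2 * c ->
  s <= z + C + e -> 2 * e <= s -> 2 * e <= a * t -> t + a * q <= s + x ->
  z <= 1 -> z <= s -> a * a <= b2 -> L <= r + q -> d <= s + y ->
  ~ (r <= 1 \/ b2 * r <= d).
Proof.
move=> a0 H1 H0 H2 H3 H4 H5 z1 zs ab Lr ds.
have K1 : y + x + 2 * C + a + 2 <= a * L by rewrite mulnDr in H1; lia.
have K2 : a * (y + x + 2 * C + a + 2) <= a * (a * L) by rewrite leq_mul2l K1 orbT.
have K3 : a * s <= a * (z + C + e) by rewrite leq_mul2l H2 orbT.
have K4 : a * (t + a * q) <= a * (s + x) by rewrite leq_mul2l H5 orbT.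
have K5 : (a.-1) * (2 * e) <= a.-1 * s by rewrite leq_mul2l H3 orbT.
have K6 : a * z <= a by rewrite -{2}(muln1 a) leq_mul2l z1 orbT.
have K7 : a * (a * L) <= a * (a * r) + a * (a * q) by rewrite -!mulnDr !leq_mul2l Lr !orbT.
have K8 : y <= a * y by rewrite leq_pmull.
have K9 : a * e = a.-1 * e + e by rewrite -{1}(prednK a0) mulSn addnC.
have K10 : a * s = a.-1 * s + s by rewrite -{1}(prednK a0) mulSn addnC.
(* With [K7] this becomes [a^2 + s + y + 2a <= a^2 r + 2az]. If [r <= 1], then [s + y + 2a <= 2az]
   remains, where [z = 0] contradicts [0 < a] and [z = 1] contradicts [z <= s]. Otherwise
   [a^2 r <= d <= s + y] leaves [a^2 + 2a <= 2az <= 2a]. *)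
have K11 : a * a + a * (a * q) + s + y + 2 * a <= a * (a * L) + 2 * (a * z).
  rewrite !mulnDr in K2 K3 K4; lia.
move: {K2 K3 K4 K5 K8 K9 K10 H0 H1 H2 H3 H4 H5 K1} K11 => K11 [r1|br].
  have : a * (a * r) <= a * a by rewrite leq_mul2l -{3}(muln1 a) leq_mul2l r1 !orbT.
  case: z z1 zs K6 K11 => [|[|//]] _ zs _ K11; lia.
have : a * a * r <= b2 * r by rewrite leq_mul2r ab orbT.
have : 0 < a * a by rewrite muln_gt0 a0.
rewrite -mulnA; lia.
Qed.

(** Without parallel edges, the edges at [v] have distinct other ends, all in [X :\ v]. *)
Lemma simple_inside_degree (V E : finType) (ends : E -> {set V}) (F : {set E}) (X : {set V}) v :
  (forall e, #|ends e| = 2) -> {in F &, injective ends} -> v \in X ->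
  #|[set e in F | (v \in ends e) && (ends e \subset X)]| < #|X|.
Proof.
move=> e2 simF vX; rewrite (cardsD1 v X) vX ltnS.
set B := [set e in F | _]; pose f e := ends e :\ v.
rewrite -(card_in_imset (f := f) (D := B)).
  rewrite -(card_imset (X :\ v) (@set1_inj _)); apply: subset_leq_card;
    apply/subsetP => _ /imsetP[e eB ->].
  move: eB; rewrite inE => /and3P[_ ve eX]; have : #|f e| == 1.
    by move: (e2 e); rewrite (cardsD1 v) ve add1n => -[/eqP].
  move=> /cards1P[w fw]; rewrite fw imset_f // -sub1set -fw; exact: setSD.
move=> e e'; rewrite !inE => /and3P[eF ve _] /and3P[e'F ve' _] ff.
by apply: simF => //; rewrite -(setD1K ve) -(setD1K ve') -/(f e) ff.
Qed.

(** * Maximal sparse subsets and maximal feasible sets *)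

Section Extension.
Variables (G : mgraph) (m : nat) (F : {set edge G}).
Local Notation ends := (@ends G).

Lemma max_sparse_subset : exists F0 : {set edge G}, [/\ F0 \subset F, sparse m ends F0 &
  forall e, e \in F -> e \notin F0 -> exists2 X, tight m ends F0 X & ends e \subset X].
Proof.
case: (@arg_maxnP _ set0 (fun B : {set edge G} => (B \subset F) && sparse m ends B) (fun B =>
  #|B|)).
  by rewrite sub0set sparse0.
move=> F0 /andP[F0F sp] maxF0; exists F0; split=> // e eF eF0.
case: (boolP [exists X : {set G}, tight m ends F0 X && (ends e \subset X)]) => [/existsP[X
  /andP[]]|/existsPn nX].
  by exists X.
have := maxF0 (e |: F0);
  rewrite subUset sub1set eF F0F cardsU1 eF0 sparse_add //= => [/(_ isT)|X tX].
  by rewrite add1n /= ltnn.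
by have := nX X; rewrite tX.
Qed.

Lemma max_feasible (F0 L : {set edge G}) : sparse m ends F0 ->
  exists2 A : {set edge G}, feasible m ends F0 L A & forall B, feasible m ends F0 L B -> #|B| <=
    #|A|.
Proof.
move=> spF0.
pose fb (B : {set edge G}) := [&& F0 \subset B, B :\: F0 \subset L, sparse m ends B & [forall e,
  forall e', forall v,
  [&& e \in B :\: F0, e' \in B :\: F0, v \in ends e & v \in ends e'] ==> (e == e')]].
have fP B : reflect (feasible m ends F0 L B) (fb B).
  apply: (iffP and4P) => [] [h1 h2 h3 h4]; split=> //.
    move=> e e' v eB e'B ve ve'; have /forallP/(_ e')/forallP/(_ v) := forallP h4 e.
    by rewrite eB e'B ve ve' => /eqP.
  apply/forallP => e; apply/forallP => e'; apply/forallP => v;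
    apply/implyP => /and4P[eB e'B ve ve'].
  by apply/eqP; apply: (h4 e e' v).
have fF0 : fb F0 by apply/fP; split=> //; rewrite setDv ?sub0set // => e e' v; rewrite inE.
case: (@arg_maxnP _ F0 fb (fun B => #|B|) fF0) => A /fP fA maxA.
by exists A => // B /fP; apply: maxA.
Qed.

End Extension.

(** * Counting parts, crossing edges and removed edges when the whole vertex set is not tight *)

Section Counting.
Variables (G : mgraph) (m : nat) (F F0 A : {set edge G}) (Z0 S : {set G}).
Local Notation ends := (@ends G).
Hypothesis simF : {in F &, injective ends}.
Hypothesis degF : forall v, 2 * m <= deg F v.
Hypothesis spanF : forall e, e \in F -> e \notin F0 -> exists2 X, tight m ends F0 X & ends e
  \subset X.
Hypothesis F0A : F0 \subset A.
Hypothesis spA : sparse m ends A.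
Hypothesis ntA : ~~ tight m ends A [set: G].
Hypothesis maA : matching ends (A :\: F0).
Hypothesis inhG : 0 < #|G|.
Hypothesis SZ0 : S \subset Z0 :|: \bigcup_(e in A :\: F0) ends e.

Let e2 := @endsP G.
Let K := avoid ends F0 A S.

Let KA : K \subset A. Proof. exact: avoid_sub. Qed.
Let F0K : F0 \subset K.
Proof. by apply/subsetP => e eF; rewrite inE eF (subsetP F0A). Qed.
Let spK : sparse m ends K. Proof. exact: sparse_sub spA. Qed.

Variable tail : edge G -> G.
Hypothesis tailE : forall e, tail e \in ends e.

Local Notation part := (part m ends K).
Local Notation P := (parts m ends K).
Local Notation inner := (inner m ends K tail).

Definition large v := 2 * m < #|part v|.
Definition large_parts : {set {set G}} := [set X in P | 2 * m < #|X|].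
Definition small_parts : {set {set G}} := [set X in P | ~~ (2 * m < #|X|)].
Definition crossing : {set edge G} := [set e in K | ~~ inner e].
Definition removed : {set edge G} := A :\: K.
Definition removed_in : {set edge G} := [set e in removed | ends e \subset S].
Definition touched : {set {set G}} := [set X in P | X :&: S != set0].
Definition cross_some : {set edge G} := [set e in crossing | [exists v in ends e, large v]].
Definition cross_all : {set edge G} := [set e in crossing | [forall v in ends e, large v]].
(* An end of [e] outside the large parts if there is one: deleting it then uses up no vertex of
   a large part. *)
Definition pick_end e : G := if [pick v in ends e | ~~ large v] is Some v then v else tail e.
Definition cut : {set G} := S :|: pick_end @: cross_some.
Definition swallowed : {set {set G}} := [set X in large_parts | X \subset cut].

Lemma removedP e : e \in removed ->
  [/\ e \in A :\: F0, ~~ (ends e \subset ~: S) & e \notin K].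
Proof.
move=> /setDP[eA eK]; have := eK; rewrite [e \in K]inE eA negb_or => /andP[eF eS].
by split=> //; rewrite ?in_setD ?eF ?eS.
Qed.

Lemma large_part v : large v = (part v \in large_parts).
Proof. by rewrite inE /large imset_f. Qed.

Lemma large_partsP : large_parts \subset P.
Proof. by apply/subsetP => X; rewrite inE => /andP[]. Qed.

Lemma card_partsE : #|P| = #|large_parts| + #|small_parts|.
Proof.
rewrite -(cardsID [set X : {set G} | 2 * m < #|X|] P); congr (_ + _); apply: eq_card => X.
  by rewrite !inE.
by rewrite !inE andbC.
Qed.

(** With [n] vertices and [p] parts there are [m n - m p] inner edges; the other edges of [A] are
    crossing or removed. As the whole set is not tight, [A] has fewer than [m n - m] edges, and
    doubling this strict inequality gives the [2]. *)
Lemma crossing_count :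
  2 * #|crossing| + 2 * #|removed| + 2 * m + 2 <= 2 * m * (#|large_parts| + #|small_parts|).
Proof.
have arith i p k c r a v : i + p = v -> c + i = k -> k + r = a -> a + m < v ->
    2 * c + 2 * r + 2 * m + 2 <= 2 * p by clear; lia.
have := card_inner e2 spK tailE (subxx P).
have -> : covered_by m ends K P = [set: G] by apply/setP => v; rewrite !inE imset_f.
have -> : [set e in K | inner e & part (tail e) \in P] = K :\: crossing.
  apply/setP => e; rewrite in_setD [e \in crossing]inE [LHS]inE imset_f // andbT.
  by case: (e \in K); rewrite ?andbF //= negbK andbT.
have := cardsID crossing K; have -> : K :&: crossing = crossing.
  by apply/setIidPr/subsetP => e; rewrite inE => /andP[].
have cA : #|K| + #|removed| = #|A| by rewrite -(cardsID K A) (setIidPr KA).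
have : #|A| + m < m * #|[set: G]|.
  have T0 : [set: G] != set0 by rewrite -card_gt0 cardsT.
  have := elimT (sparseP _ _ _) spA _ T0; rewrite leq_eqVlt.
  move: ntA; rewrite /tight T0 /= => /negbTE ->.
  by rewrite (_ : inside _ _ _ = A) //; apply/setP => e; rewrite inE subsetT andbT.
by rewrite -card_partsE -mulnA => cAV cK cI; apply: arith cI cK cA cAV.
Qed.

(** Of the [2m] or more edges of [F] at [v], fewer than [#|part v|] stay in the part, as [F] is
    simple. The others are spanned by no tight set of [K], so they belong to [F0], hence to [K], and
    cross. *)
Lemma crossing_degree v : 2 * m < #|[set e in crossing | v \in ends e]| + #|part v|.
Proof.
have vX := mem_part e2 spK v.
have := simple_inside_degree e2 simF vX; rewrite -(leq_add2l #|[set e in crossing | v \in ends e]|).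
apply: leq_trans; rewrite addnS ltnS; apply: leq_trans (degF v) _.
apply: leq_trans (leq_card_setU _ _); rewrite subset_leq_card //.
apply/subsetP => e; rewrite !inE => /andP[eF ve]; rewrite eF ve /= andbT.
case: (boolP (ends e \subset part v)) => [_|eX]; first by rewrite orbT.
rewrite orbF (innerP e2 spK tailE ve) eX andbT.
case: (boolP (e \in F0)) => eF0; first by rewrite (subsetP F0A).
have [X tX eX'] := spanF eF eF0; case/negP: eX; apply: (subset_trans eX').
by apply: tight_sub_part => //; [exact: sub_tight F0K spK tX | apply: (subsetP eX')].
Qed.

(** Counts ends of crossing edges: those in large parts cover [cross_some] once and [cross_all] once
    more, and each small part receives at least [2m] by [crossing_degree]. *)
Lemma small_count : 2 * m * #|small_parts| + #|cross_some| + #|cross_all| <= 2 * #|crossing|.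
Proof.
pose VL := [set v | large v].
have -> : 2 * #|crossing| = \sum_(e in crossing) #|ends e :&: VL| + \sum_(e in crossing) #|ends e
  :&: ~: VL|.
  rewrite -big_split /= mulnC -sum_nat_const; apply: eq_bigr => e _.
  by rewrite -(e2 e) -(cardsID VL (ends e)) setDE.
rewrite -addnA addnC leq_add //; last first.
  rewrite sum_incidence.
  rewrite (partition_big part (mem small_parts)) /=; last first.
    by move=> v; rewrite !inE => vL; rewrite imset_f.
  rewrite mulnC -sum_nat_const; apply: leq_sum => X XS.
  have XP : X \in P by move: XS; rewrite inE => /andP[].
  rewrite (eq_bigl [in X]) => [|v]; last first.
    rewrite !inE part_in // andb_idl // => vX; have /eqP pX : part v == X by rewrite part_in.
    by rewrite /large pX; move: XS; rewrite inE => /andP[].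
  have : \sum_(v in X) (2 * m).+1 <= \sum_(v in X) (#|[set e in crossing | v \in ends e]| + #|X|).
    apply: leq_sum => v vX; have /eqP <- : part v == X by rewrite part_in.
    exact: crossing_degree.
  rewrite big_split /= !sum_nat_const.
  (* [n (2m + 1 - n) - 2m] equals [(n - 1)(2m - n)]. *)
  have arith n d : 0 < n -> n <= 2 * m -> n * (2 * m).+1 <= d + n * n -> 2 * m <= d by clear; nia.
  have n0 : 0 < #|X| by have /(mem_partsP e2 spK)[x xX _] := XP; apply/card_gt0P; exists x.
  have n2 : #|X| <= 2 * m by move: XS; rewrite inE -leqNgt => /andP[].
  exact: arith.
rewrite /cross_some /cross_all -!sum1dep_card !big_mkcondr -big_split /=.
apply: leq_sum => e _.
case: existsP => [[v /andP[ve vL]]|nE]; last first.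
  by case: forallP => // fA; case: nE; exists (tail e); have := fA (tail e); rewrite tailE.
case: forallP => [fA|_].
  rewrite -[leqLHS](e2 e) subset_leq_card // subsetI subxx; apply/subsetP => w we; rewrite inE.
  by have := fA w; rewrite we.
by apply/card_gt0P; exists v; rewrite !inE ve.
Qed.

(** A vertex of [S] outside [Z0] is an end of a matching edge, which is removed because it meets
    [S]. Only edges of [removed_in] have both ends in [S]. *)
Lemma removed_cover : #|S| <= #|Z0| + #|removed| + #|removed_in|.
Proof.
have : #|S| <= #|Z0| + #|S :\: Z0| by rewrite -(cardsID Z0 S) leq_add2r subset_leq_card ?subsetIr.
move/leq_trans; apply; rewrite -addnA leq_add2l.
apply: (@leq_trans (\sum_(v in S :\: Z0) #|[set e in removed | v \in ends e]|)).
  rewrite -sum1_card; apply: leq_sum => v; rewrite inE => /andP[vZ vS].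
  have := subsetP SZ0 v vS; rewrite inE (negbTE vZ) => /bigcupP[e eAF ve].
  apply/card_gt0P; exists e; rewrite inE ve andbT; move: eAF; rewrite !inE => /andP[eF eA].
  rewrite eA (negbTE eF) andbT /=; apply/negP => /subsetP/(_ v ve); by rewrite inE vS.
rewrite -sum_incidence -sum1_card /removed_in -sum1dep_card big_mkcondr -big_split /=.
apply: leq_sum => e _; case: ifP => eS; first by rewrite -[leqRHS](e2 e) subset_leq_card ?subsetIl.
rewrite addn0 -ltnS -[ltnRHS](e2 e); apply: proper_card; rewrite properE subsetIl subsetI subxx /=.
by apply: contraFN eS => /subset_trans; apply; apply: subsetDl.
Qed.

Lemma removed_in_half : 2 * #|removed_in| <= #|S|.
Proof.
have -> : 2 * #|removed_in| = \sum_(e in removed_in) #|ends e :&: S|.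
  rewrite mulnC -sum_nat_const; apply: eq_bigr => e; rewrite inE => /andP[_ /setIidPl ->].
  by rewrite e2.
rewrite sum_incidence -sum1_card; apply: leq_sum => v _.
apply/card_le1_eqP => e e' /setIdP[/setIdP[eR _] ve] /setIdP[/setIdP[e'R _] ve'].
have [eA _ _] := removedP eR; have [e'A _ _] := removedP e'R.
exact: (maA e'A eA ve' ve).
Qed.

(** The touched parts cover [S]. If there are [t] of them, sparsity leaves [A] at most [m (t - 1)]
    edges within their union besides the inner ones, and [removed_in] is among these. *)
Lemma removed_in_touched : 2 * #|removed_in| <= 2 * m * #|touched|.
Proof.
rewrite -mulnA leq_mul2l /=.
have [->|[e0 e0R]] := set_0Vmem removed_in; first by rewrite cards0.
have TP : touched \subset P by apply/subsetP => X; rewrite inE => /andP[].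
have := card_inner e2 spK tailE TP; set U := covered_by _ _ _ _; set N := [set e in K | _] => cN.
have SU : S \subset U.
  apply/subsetP => v vS; rewrite !inE imset_f //=; apply/set0Pn; exists v.
  by rewrite inE vS mem_part.
have U0 : U != set0.
  apply/set0Pn; exists (tail e0); apply: (subsetP SU); move: e0R;
    rewrite inE => /andP[_ /subsetP]; exact.
have leU := elimT (sparseP _ _ _) spA U U0.
have leN : #|N| + #|removed_in| <= #|inside ends A U|.
  rewrite -cardsUI (_ : N :&: removed_in = set0) ?cards0 ?addn0; last first.
    apply/setP => e; rewrite in_set0; apply/negP; rewrite !in_setI => /andP[].
    by rewrite inE => /andP[eK _]; rewrite inE => /andP[/removedP[_ _]]; rewrite eK.
  rewrite subset_leq_card // subUset; apply/andP; split; apply/subsetP => e; rewrite inE.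
    move=> /and3P[eK eI eT]; rewrite inE (subsetP KA) //=; apply/subsetP => v ve.
    have eP : ends e \subset part v by rewrite -(innerP e2 spK tailE).
    by rewrite inE -(part_eq e2 spK (subsetP eP _ (tailE e))).
  by move=> /andP[eR eS]; have [/setDP[eA _] _ _] := removedP eR; rewrite inE eA (subset_trans eS).
have arith n r i u t : n + r <= i -> i + m <= u -> n + t = u -> r <= t by clear; lia.
exact: arith leN leU cN.
Qed.

(** A swallowed part has more than [2m] vertices. Those outside [S] are picked ends, and an end in a
    large part is picked only for an edge of [cross_all]. A touched part that is not swallowed
    contains a vertex of [S] outside the swallowed parts. *)
Lemma swallowed_count : #|touched| + 2 * m * #|swallowed| <= #|S| + #|cross_all|.
Proof.
have QP : swallowed \subset P by apply/subsetP => X; rewrite inE => /andP[/(subsetP large_partsP)].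
have := card_covered_by e2 spK QP; set W := covered_by _ _ _ _ => cW.
have le_qw : (2 * m).+1 * #|swallowed| <= #|W|.
  rewrite cW mulnC -sum_nat_const; apply: leq_sum => X; rewrite inE => /andP[+ _].
  by rewrite inE => /andP[].
have le_ws : #|W| <= #|S :&: W| + #|cross_all|.
  have WS : W \subset (S :&: W) :|: pick_end @: cross_all.
    apply/subsetP => v vW; have vQ : part v \in swallowed by move: vW; rewrite inE.
    have vL : large v by rewrite large_part; move: vQ; rewrite inE => /andP[].
    have : v \in cut by move: vQ; rewrite inE => /andP[_ /subsetP]; apply; apply: mem_part.
    move=> /setUP[vS|/imsetP[e eX vE]]; first by rewrite in_setU in_setI vS vW.
    rewrite in_setU; apply/orP; right; apply/imsetP; exists e => //.
    move: eX; rewrite !inE => /andP[-> _] /=; apply/forallP => w; apply/implyP => we.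
    move: vE; rewrite /pick_end; case: pickP => [u /andP[_ uL] vu|/(_ w)];
      first by rewrite vu (negbTE uL) in vL.
    by rewrite /= we /= => /negbFE.
  apply: leq_trans (subset_leq_card WS) _; apply: leq_trans (leq_card_setU _ _) _.
  by rewrite leq_add2l leq_imset_card.
have le_t : #|touched| <= #|swallowed| + #|S :\: W|.
  have TS : touched \subset swallowed :|: part @: (S :\: W).
    apply/subsetP => X; rewrite inE => /andP[XP /set0Pn[v /setIP[vX vS]]].
    have /eqP pv : part v == X by rewrite part_in.
    case: (boolP (X \in swallowed)) => XQ; first by rewrite in_setU XQ.
    rewrite in_setU; apply/orP; right; apply/imsetP; exists v => //.
    by rewrite in_setD vS andbT inE pv.
  apply: leq_trans (subset_leq_card TS) _; apply: leq_trans (leq_card_setU _ _) _.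
  by rewrite leq_add2l leq_imset_card.
have arith q w sw x t sd n : (2 * m).+1 * q <= w -> w <= sw + x -> t <= q + sd -> sw + sd = n ->
    t + 2 * m * q <= n + x by clear; rewrite mulSn; lia.
exact: arith le_qw le_ws le_t (cardsID W S).
Qed.

(** Crossing edges between small parts are not cut, so all vertices outside the large parts share
    one label. *)
Definition part_label (v : G) : option {set G} := if large v then Some (part v) else None.

Lemma label_count : #|large_parts| <= #|part_label @: (~: cut)| + #|swallowed|.
Proof.
rewrite -(cardsID swallowed large_parts) addnC leq_add //; last first.
  by rewrite subset_leq_card // subsetIr.
rewrite -(card_imset _ (@Some_inj _)) subset_leq_card //; apply/subsetP => _ /imsetP[X + ->].
rewrite in_setD inE negb_and => /andP[+ XL]; rewrite XL /= => /subsetPn[v vX vC].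
have XP := subsetP large_partsP X XL.
have /eqP pv : part v == X by rewrite part_in.
by apply/imsetP; exists v; rewrite ?in_setC // /part_label large_part pv XL.
Qed.

Lemma card_cut : #|cut| <= #|S| + #|cross_some|.
Proof. by apply: leq_trans (leq_card_setU _ _) _; rewrite leq_add2l leq_imset_card. Qed.

(** If [e] is not inner, no tight set of [K] spans it, so [e] is in [A]: by [spanF] if it lies in
    [F], by [spanned_off] otherwise. Thus it crosses, and with an end in a large part it would have
    had one of its ends put in the cut; so both labels are [None]. *)
Lemma label_constant (L : {set edge G}) : Z0 \subset S ->
  (forall e, e \notin F -> [disjoint ends e & Z0] -> e \in L) -> spanned_off m ends F0 L A S ->
  forall e x y, x \in ends e -> y \in ends e -> x \notin cut -> y \notin cut ->
  part_label x = part_label y.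
Proof.
move=> Z0S LP /forallP clS e x y xe ye xC yC; case: (eqVneq x y) => [->//|xy].
have eE : ends e = [set x; y].
  by apply/esym/eqP; rewrite eqEcard e2 cards2 xy subUset !sub1set xe ye.
have eS : ends e \subset ~: S.
  by rewrite eE subUset !sub1set !in_setC; move: xC yC;
    rewrite !in_setU !negb_or => /andP[-> _] /andP[-> _].
case: (boolP (inner e)) => eI.
  have xP : y \in part x by have := eI; rewrite (innerP e2 spK tailE xe) => /subsetP; apply.
  by rewrite /part_label !large_part (part_eq e2 spK xP).
have nt X : tight m ends K X -> ~~ (ends e \subset X).
  by move=> tX; apply: contraNN eI; apply: inner_tight.
have eA : e \in A.
  case: (boolP (e \in F)) => eF.
    case: (boolP (e \in F0)) => eF0; first by rewrite (subsetP F0A).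
    have [X tX eX] := spanF eF eF0; have tXK : tight m ends K X := sub_tight F0K spK tX.
    by have := nt X tXK; rewrite eX.
  apply: contraT => eA; have := clS e; rewrite eA eS LP //=; last first.
    by rewrite disjoints_subset (subset_trans eS) // setCS.
  by case/existsP => X /andP[tX eX]; case/negP: (nt X tX).
have eX : e \in crossing by rewrite inE eI andbT inE eA eS orbT.
have : pick_end e \in ends e.
  by rewrite /pick_end; case: pickP => [u /andP[]//|_]; apply: tailE.
have nP : e \in cross_some -> pick_end e \notin ends e.
  move=> eCS; rewrite eE !inE; apply/negP => /orP[]/eqP pE.
    by case/negP: xC; rewrite in_setU -pE imset_f ?orbT.
  by case/negP: yC; rewrite in_setU -pE imset_f ?orbT.
move=> pe; have : e \notin cross_some by apply/negP => /nP; rewrite pe.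
rewrite inE eX /= => /existsPn nL; rewrite /part_label.
by have := nL x; have := nL y; rewrite xe ye /= => /negbTE -> /negbTE ->.
Qed.

End Counting.

Lemma tree_connected_extension (R : realFieldType) (G : mgraph) (b m : nat)
    (F : {set edge G}) (Z0 : {set G}) :
  0 < m -> 2 * m <= b -> tough ((b ^ 2)%:R%R : R) G -> 0 < #|G| ->
  {in F &, injective (@ends G)} -> (forall v, 2 * m <= deg F v) -> #|Z0| <= 1 ->
  exists M : {set edge G}, [/\ [disjoint M & F],
    forall e, e \in M -> [disjoint ends e & Z0],
    matching (@ends G) M & tree_connected m (F :|: M)].
Proof.
move=> m0 mb tG inhG simF degF Z1; have e2 := @endsP G.
have [F0 [F0F spF0 spanF]] := max_sparse_subset m F.
(* [L] avoids all of [F], not only [F0], so that the matching is disjoint from [F]. *)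
pose L := [set e | (e \notin F) && [disjoint ends e & Z0]].
have [A fA maxA] := max_feasible L spF0; have [F0A AL spA maA] := fA.
have LF0 : [disjoint L & F0].
  rewrite disjoint_sym; apply: disjointWl F0F _; apply/pred0P => e /=; rewrite inE.
  by case: (e \in F).
have LZ0 e : e \in L -> [disjoint ends e & Z0] by rewrite inE => /andP[].
case: (boolP (tight m (@ends G) A [set: G])) => [tA|ntA].
  exists (A :\: F0); split=> //.
  - apply: disjointWl AL _; apply/pred0P => e /=; rewrite inE.
    by case: (e \in F); rewrite ?andbF.
  - by move=> e /(subsetP AL)/LZ0.
  - apply: sparse_tree_connected spA tA; apply/subsetP => e eA; rewrite !inE eA andbT.
    by case: (boolP (e \in F0)) => [/(subsetP F0F) ->|]; rewrite ?orbT.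
have [S [Z0S SZ clS]] := win_closed e2 LF0 LZ0 fA maxA.
have tl (e : edge G) : {v : G | v \in ends e} by apply: sigW; apply/set0Pn; rewrite -cards_eq0 e2.
pose tail e := sval (tl e); have tailE e : tail e \in ends e := svalP (tl e).
have b0 : 0 < b ^ 2 by rewrite expn_gt0; lia.
exfalso; apply: (@toughness_contradiction (2 * m) (b ^ 2) #|large_parts m F0 A S|
  #|swallowed m F0 A S tail| #|small_parts m F0 A S| #|cross_some m F0 A S tail|
  #|cross_all m F0 A S tail| #|removed F0 A S| #|removed_in F0 A S| #|S| #|Z0|
  #|touched m F0 A S| #|crossing m F0 A S tail|
  #|part_label m F0 A S @: (~: cut m F0 A S tail)| #|cut m F0 A S tail|).
- by rewrite muln_gt0 m0.
- exact: (crossing_count F0 S spA ntA inhG tailE).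
- exact: (small_count S simF degF spanF F0A spA tailE).
- exact: (removed_cover SZ).
- exact: (removed_in_half S maA).
- exact: (removed_in_touched F0 S spA tailE).
- exact: (swallowed_count F0 S spA tail).
- by [].
- exact: subset_leq_card.
- by rewrite -mulnn leq_mul.
- exact: (label_count F0 S spA tail).
- exact: card_cut.
- apply: (tough_label b0 tG) => e x y.
  by apply: (label_constant spanF F0A spA tailE Z0S _ clS) => g gF gZ; rewrite inE gF.
Qed.

(** * The Tutte-Berge formula *)

Section TutteBerge.
Variables (N : finType) (r : rel N).
Hypothesis rsym : symmetric r.
Hypothesis rirr : irreflexive r.
Implicit Types (X Y B : {set N}) (mu nu : {ffun N -> N}).

(* A matching of the subgraph induced on [X] is an involution moving vertices of [X] only
   along edges; its fixed points are the unmatched vertices. *)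
Definition is_matching X mu : bool :=
  [forall x, (mu (mu x) == x) && ((mu x != x) ==> (x \in X) && r x (mu x))].

Definition unmatched X mu : {set N} := [set x in X | mu x == x].

Definition induced X : rel N := [rel x y | [&& x \in X, y \in X & r x y]].

Lemma is_matchingP X mu :
  reflect ((forall x, mu (mu x) = x) /\ forall x, mu x != x -> x \in X /\ r x (mu x))
    (is_matching X mu).
Proof.
apply: (iffP forallP) => [H|[H1 H2] x].
  split=> x; have /andP[/eqP m1 /implyP m2] := H x => //.
  by move=> /m2/andP[].
by rewrite H1 eqxx /=; apply/implyP => /H2[-> ->].
Qed.

Lemma matching_in X mu x : is_matching X mu -> x \in X -> mu x \in X.
Proof.
move=> /is_matchingP[inv mat] xX; case: (eqVneq (mu x) x) => [->//|mx].
by have [] := mat (mu x); rewrite ?inv // eq_sym.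
Qed.

Lemma even_fixfree mu (D : {set N}) : (forall x, mu (mu x) = x) ->
  (forall x, x \in D -> mu x \in D) -> (forall x, x \in D -> mu x != x) -> ~~ odd #|D|.
Proof.
move=> inv; have [n] := ubnP #|D|; elim: n D => // n IH D Dn stD ffD.
have [->|[x xD]] := set_0Vmem D; first by rewrite cards0.
have mxD : mu x \in D :\ x by rewrite !inE ffD // stD.
rewrite (cardsD1 x) xD (cardsD1 (mu x) (D :\ x)) mxD /= negbK.
apply: IH => [|y|y]; first by move: Dn; rewrite (cardsD1 x) xD (cardsD1 (mu x) (D :\ x)) mxD; lia.
  rewrite !inE => /and3P[ymx yx yD]; rewrite stD // andbT.
  by rewrite (inj_eq (can_inj inv)) yx /= -(inj_eq (can_inj inv)) inv.
by rewrite !inE => /and3P[_ _]; apply: ffD.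
Qed.

Lemma odd_unmatched X mu : is_matching X mu -> odd #|unmatched X mu| = odd #|X|.
Proof.
move=> mat; have /is_matchingP[inv _] := mat.
have : ~~ odd #|X :\: unmatched X mu|.
  apply: (even_fixfree inv) => x; rewrite !inE => /andP[].
    move=> + xX; rewrite xX /= => mx; rewrite (matching_in mat) // andbT inv.
    by rewrite eq_sym.
  by move=> + xX; rewrite xX.
rewrite -(cardsID (unmatched X mu) X) oddD => /negbTE ->; rewrite addbF.
by congr (odd _); apply: eq_card => x; rewrite !inE; case: (x \in X).
Qed.

(* Matches [x] with [y]; [z] is meant to be the former partner of [y]. *)
Definition swap mu (x y z : N) : {ffun N -> N} :=
  [ffun w => if w == x then y else if w == y then x else if w == z then z else mu w].

Lemma swap_matching X mu x y : is_matching X mu -> x \in X -> y \in X -> r x y -> mu x = x ->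
  is_matching X (swap mu x y (mu y)).
Proof.
move=> /is_matchingP[inv mat] xX yX rxy mx.
have xy : x != y by apply: contraTneq rxy => ->; rewrite rirr.
have yx : (y == x) = false by rewrite eq_sym; apply: negbTE.
have myx : mu y != x by rewrite -(inj_eq (can_inj inv)) inv mx yx.
have mne a c : a != mu c -> mu a != c by apply: contraNneq => <-; rewrite inv.
apply/is_matchingP; split=> w.
  rewrite /swap !ffunE; case: (eqVneq w x) => [->|wx]; first by rewrite yx eqxx.
  case: (eqVneq w y) => [->|wy]; first by rewrite eqxx.
  case: (eqVneq w (mu y)) => [wz|wz]; first by rewrite -wz (negbTE wx) (negbTE wy) eqxx.
  rewrite (negbTE (mne w x _)) ?mx // (negbTE (mne w y wz)).
  by rewrite (inj_eq (can_inj inv)) (negbTE wy) inv.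
rewrite !ffunE; case: (eqVneq w x) => [->|wx]; first by [].
case: (eqVneq w y) => [->|wy]; first by rewrite rsym.
by case: (eqVneq w (mu y)) => [wz|wz]; [rewrite wz eqxx | apply: mat].
Qed.

Lemma unmatched_swap X mu x y : is_matching X mu -> x \in X -> y \in X -> r x y -> mu x = x ->
  unmatched X (swap mu x y (mu y)) = (mu y |: unmatched X mu) :\ x :\ y.
Proof.
move=> mat xX yX rxy mx; have /is_matchingP[inv _] := mat.
have xy : x != y by apply: contraTneq rxy => ->; rewrite rirr.
apply/setP => w; rewrite !inE !ffunE.
case: (eqVneq w x) => [->|wx]; first by rewrite eq_sym (negbTE xy) /= andbF.
case: (eqVneq w y) => [->|wy]; first by rewrite (negbTE xy) andbF.
by case: (eqVneq w (mu y)) => [->|wz] //=; rewrite eqxx andbT (matching_in mat).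
Qed.

Definition optimal X mu : Prop :=
  is_matching X mu /\ forall nu, is_matching X nu -> #|unmatched X mu| <= #|unmatched X nu|.

Lemma optimal_exists X : exists mu, optimal X mu.
Proof.
have id_mat : is_matching X [ffun x => x].
  by apply/is_matchingP; split=> x; rewrite !ffunE ?eqxx.
case: (@arg_minnP _ [ffun x => x] (is_matching X) (fun mu => #|unmatched X mu|) id_mat) => mu mat
  min.
by exists mu; split.
Qed.

Lemma optimal_adjacent X mu x y : optimal X mu -> x \in X -> y \in X -> r x y ->
  mu x = x -> mu y != y.
Proof.
move=> [mat opt] xX yX rxy mx; apply/negP => /eqP my.
have := opt _ (swap_matching mat xX yX rxy mx); rewrite (unmatched_swap mat) //.
rewrite leqNgt => /negP[]; apply: proper_card; rewrite my properE; apply/andP; split.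
  by apply/subsetP => w; rewrite !inE => /and3P[_ _ /orP[/eqP->|//]]; rewrite yX my /=.
by apply/subsetPn; exists x; rewrite !inE ?xX ?mx ?eqxx ?andbF.
Qed.

(** The relation of Gallai's lemma. When every vertex is missed by some optimal matching it is
    transitive, so it spreads from adjacent vertices to whole components. *)
Definition apart X x y : Prop := forall mu, optimal X mu -> mu x = x -> mu y = y -> x = y.

Lemma apart_trans X y x z : {in X, forall v, exists2 mu, optimal X mu & mu v = v} ->
  x \in X -> y \in X -> z \in X -> apart X x y -> apart X y z -> apart X x z.
Proof.
move=> miss xX yX zX axy ayz mu omu mx mz; apply/eqP; apply: contraT => xz.
have xy : x != y by apply: contraNneq xz => xy; rewrite xy; apply/eqP/(ayz mu); rewrite // -xy.
have zy : z != y by apply: contraNneq xz => zy; rewrite zy; apply/eqP/(axy mu); rewrite // -zy.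
(* Among the optimal matchings missing [y], take one sharing as many edges as possible with
   [mu]; a further edge of [mu] can then be swapped in, which is absurd. *)
pose agree nu := #|[set w | (mu w == nu w) && (mu w != w)]|.
pose cand nu := [&& is_matching X nu, #|unmatched X nu| == #|unmatched X mu| & nu y == y].
have [nu0 onu0 nu0y] := miss y yX; have [mat opt] := omu.
have cnu0 : cand nu0.
  by rewrite /cand onu0.1 nu0y eqxx eqn_leq (onu0.2 _ mat) (opt _ onu0.1).
case: (@arg_maxnP _ nu0 cand agree cnu0) => nu /and3P[matnu /eqP cnu /eqP nuy] maxnu.
have onu : optimal X nu by split=> // k /opt; rewrite cnu.
have nx : nu x != x by apply: contraNneq xy => nx; apply/eqP/(axy nu).
have nz : nu z != z by apply: contraNneq zy => nz; apply/eqP/esym/(ayz nu).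
(* Both matchings miss equally many vertices, and [x] and [z] are missed by [mu] alone. So at least
   two vertices are missed by [nu] alone, one of them not [y]. *)
have [w wy] : exists2 w, w != y & w \in unmatched X nu :\: unmatched X mu.
  have c2 : 1 < #|unmatched X nu :\: unmatched X mu|.
    have : 1 < #|unmatched X mu :\: unmatched X nu|.
      apply/card_gt1P; by exists x, z; split=> //; rewrite !inE ?xX ?zX ?mx ?mz eqxx ?nx ?nz.
    suff -> : #|unmatched X mu :\: unmatched X nu| = #|unmatched X nu :\: unmatched X mu| by [].
    by apply/eqP; rewrite -(eqn_add2l #|unmatched X mu :&: unmatched X nu|) cardsID setIC cardsID
      cnu.
  have [u [v [uD vD uv]]] := card_gt1P c2.
  by case: (eqVneq u y) => [uy|]; [exists v; rewrite // -uy eq_sym | exists u].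
rewrite !inE => /andP[+ /andP[wX /eqP nw]]; rewrite wX /= => mw.
have /is_matchingP[inv matr] := mat; have /is_matchingP[invn _] := matnu.
have [_ rw] := matr w mw; have mwX := matching_in mat wX.
have nmw : nu (mu w) != mu w := optimal_adjacent onu wX mwX rw nw.
have wmw : w != mu w by rewrite eq_sym.
pose nu' := swap nu w (mu w) (nu (mu w)).
have cnu' : cand nu'.
  rewrite /cand swap_matching //= (unmatched_swap matnu) //; apply/andP; split.
    apply/eqP; rewrite -cnu.
    have -> : (nu (mu w) |: unmatched X nu) :\ w :\ mu w = nu (mu w) |: (unmatched X nu :\ w).
      apply/setP => u; rewrite !inE; case: (eqVneq u (nu (mu w))) => [->|_] /=.
        rewrite nmw /= andbT; apply: contraNneq wmw => nn; apply/eqP.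
        by rewrite -(invn (mu w)) nn nw.
      by case: (eqVneq u (mu w)) => [->|//]; rewrite (negbTE nmw) !andbF.
    rewrite cardsU1 !inE invn (eq_sym (mu w)) (negbTE nmw) !andbF /= [in RHS](cardsD1 w) !inE wX
      nw eqxx.
    by [].
  rewrite ffunE (eq_sym y w) (negbTE wy); case: (eqVneq y (mu w)) => [ymw|_].
    by move: nmw; rewrite -ymw nuy eqxx.
  case: (eqVneq y (nu (mu w))) => [yn|_]; last by rewrite nuy.
  by move: nmw; rewrite -yn -(invn (mu w)) -yn nuy eqxx.
have : agree nu' <= agree nu := maxnu _ cnu'.
rewrite leqNgt => /negP[]; apply: proper_card.
rewrite properE; apply/andP; split.
  apply/subsetP => u; rewrite !inE => /andP[/eqP mn mu_]; rewrite mu_ andbT /nu' ffunE.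
  case: (eqVneq u w) => [->//|uw]; case: (eqVneq u (mu w)) => [->|umw]; first by rewrite inv.
  case: (eqVneq u (nu (mu w))) => [un|_]; last by rewrite mn.
  have : mu u = mu w by rewrite mn un invn.
  by move/(can_inj inv)/eqP; rewrite (negbTE uw).
by apply/subsetPn; exists w; rewrite !inE ?ffunE ?eqxx ?nw // negb_and mw.
Qed.

(** In place of odd components there is a matching [nu] off the barrier [B] that misses at most one
    vertex per component. A vertex missed by no optimal matching goes into [B]; when there is none,
    Gallai's lemma applies. *)
Lemma tutte_berge X : exists mu B nu, [/\ is_matching X mu, B \subset X, is_matching (X :\: B) nu,
  #|unmatched X mu| + #|B| <= #|unmatched (X :\: B) nu| &
  {in unmatched (X :\: B) nu &, forall x y, connect (induced (X :\: B)) x y -> x = y}].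
Proof.
have [n] := ubnP #|X|; elim: n X => // n IH X Xn.
pose optb mu := is_matching X mu && [forall nu, is_matching X nu ==> (#|unmatched X mu| <=
  #|unmatched X nu|)].
have optP mu : reflect (optimal X mu) (optb mu).
  apply: (iffP andP) => -[mat H]; split=> //.
    by move=> nu; apply/implyP; move: nu; apply/forallP.
  by apply/forallP => nu; apply/implyP/H.
have [mu omu] := optimal_exists X.
case: (boolP [exists v in X, [forall nu, optb nu ==> (nu v != v)]]) => [/exists_inP[v vX /forallP
  allv]|nov].
  have [|mu' [B [nu [mat' BX matnu le_u sep]]]] := IH (X :\ v).
    by move: Xn; rewrite (cardsD1 v) vX.
  have /is_matchingP[inv' mat1] := mat'.
  have m'v : mu' v = v by apply/eqP; apply: contraT => /mat1[]; rewrite !inE eqxx.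
  have matX' : is_matching X mu'.
    by apply/is_matchingP; split=> // x /mat1[]; rewrite !inE => /andP[].
  have cu' : #|unmatched X mu'| = #|unmatched (X :\ v) mu'|.+1.
    rewrite (cardsD1 v) !inE vX m'v eqxx; congr _.+1; apply: eq_card => w.
    by rewrite !inE andbA.
  have DB : X :\: (v |: B) = (X :\ v) :\: B by rewrite setDDl.
  exists mu, (v |: B), nu; rewrite DB; split=> //; first by case: omu.
    by rewrite subUset sub1set vX (subset_trans BX) ?subsetDl.
  have vB : v \notin B by apply/negP => /(subsetP BX); rewrite !inE eqxx.
  (* [mu'] misses [v], so it is not optimal on [X]. Deficiencies of matchings of [X] have equal
     parity, so its deficiency exceeds the optimum by at least two. *)
  apply: leq_trans le_u; rewrite cardsU1 vB add1n addnS -addSn leq_add2r.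
  have le1 : #|unmatched X mu| <= #|unmatched (X :\ v) mu'|.+1 by rewrite -cu'; apply: omu.2.
  have ne1 : #|unmatched X mu| != #|unmatched (X :\ v) mu'|.+1.
    apply/negP => /eqP eqc; have := allv mu'; rewrite m'v eqxx implybF => /negP[].
    by apply/optP; split=> // k /omu.2; rewrite cu' eqc.
  have := odd_unmatched omu.1; rewrite -(odd_unmatched matX') cu' /= => par.
  have : #|unmatched X mu| < #|unmatched (X :\ v) mu'|.+1 by rewrite ltn_neqAle ne1.
  rewrite ltnS leq_eqVlt => /orP[/eqP eqc|//]; by move: par; rewrite eqc; case: odd.
have miss : {in X, forall v, exists2 nu, optimal X nu & nu v = v}.
  move=> v vX; have /existsPn/(_ v) := nov; rewrite vX /= => /forallPn[nu].
  by rewrite negb_imply negbK => /andP[/optP onu /eqP nv]; exists nu.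
exists mu, set0, mu; rewrite setD0 cards0 addn0 sub0set; split=> //; try by case: omu.
move=> x y; rewrite !inE => /andP[xX /eqP mx] /andP[yX /eqP my] con.
suff ap : apart X x y by apply: (ap mu).
have [p pp yE] := connectP con; move: {con my mx} yX; rewrite {y}yE.
elim/last_ind: p pp => [|p z IHp] //=.
rewrite rcons_path last_rcons => /andP[pp /and3P[lX zX rz]] _.
apply: (apart_trans miss xX lX zX (IHp pp lX)) => k ok kl kz.
by case/eqP: (optimal_adjacent ok lX zX rz kl).
Qed.

End TutteBerge.

(** * Tutte's gadget for degree-constrained subgraphs *)

Lemma card_pairs (A B : finType) (P : pred A) (Q : A -> pred B) :
  #|[set p : A * B | P p.1 && Q p.1 p.2]| = \sum_(x | P x) #|[set y | Q x y]|.
Proof.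
rewrite -sum1dep_card -(pair_big_dep P Q (fun _ _ => 1)) /=.
by apply: eq_bigr => x _; rewrite sum1dep_card.
Qed.

Lemma card_ord_ltn b k : k <= b -> #|[set i : 'I_b | i < k]| = k.
Proof.
by move=> kb; rewrite -sum1dep_card -(big_ord_widen b (fun=> 1) kb) sum1_card card_ord.
Qed.

Lemma merge_labels (V L : finType) (g : V -> L) (C : {set V}) (s : seq (V * V)) :
  exists g' : V -> L, [/\ forall x y, g x = g y -> g' x = g' y,
    forall p, p \in s -> g' p.1 = g' p.2 & #|g @: C| <= #|g' @: C| + size s].
Proof.
elim: s => [|[u w] s [g' [g'1 g'2 g'3]]]; first by exists g; split=> //; rewrite addn0.
exists (fun x => if g' x == g' u then g' w else g' x); split.
- by move=> x y /g'1 ->.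
- move=> p; rewrite inE => /orP[/eqP ->|/g'2 -> //] /=.
  by rewrite eqxx; case: eqP.
rewrite /= addnS -addSn; apply: leq_trans g'3 _; rewrite leq_add2r.
set g'' := fun _ => _; have : g' @: C \subset g' u |: (g'' @: C).
  apply/subsetP => _ /imsetP[x xC ->]; rewrite !inE.
  case: (eqVneq (g' x) (g' u)) => //= xu; apply/imsetP; exists x => //.
  by rewrite /g'' (negbTE xu).
by move=> /subset_leq_card/leq_trans; apply; rewrite cardsU1 -add1n leq_add2r leq_b1.
Qed.

Section Gadget.
Variables (V : finType) (a : rel V).
Hypothesis asym : symmetric a.
Hypothesis airr : irreflexive a.
Variables (b : nat) (f : V -> nat).
Hypothesis fb : forall v, f v <= b.

(* Tutte's gadget: a vertex [v] becomes [f v] copies [inl (v, i)], and an edge [uw] becomes the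
   path [u - inr (u, w) - inr (w, u) - w], attached to all copies of its two ends. *)
Definition node : finType := ((V * 'I_b) + (V * V))%type.

Definition nodes : {set node} :=
  [set x : node | match x with inl p => p.2 < f p.1 | inr p => a p.1 p.2 end].

Definition gadget : rel node := fun x y =>
  match x, y with
  | inl p, inr q => p.1 == q.1
  | inr q, inl p => p.1 == q.1
  | inr p, inr q => [&& p.1 == q.2, p.2 == q.1 & a p.1 p.2]
  | _, _ => false
  end.

Lemma gadget_sym : symmetric gadget.
Proof.
move=> [p|p] [q|q] //=; apply/and3P/and3P => -[/eqP-> /eqP-> ?]; by rewrite !eqxx asym.
Qed.

Lemma gadget_irr : irreflexive gadget.
Proof. by move=> [p|[u w]] //=; apply/and3P => -[/eqP -> _]; rewrite airr. Qed.

(** An edge is kept when both its darts, [inr (u, w)] and [inr (w, u)], are matched to vertex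
    copies. A dart that is unmatched or matched to its opposite has an [inr] image. *)
Definition subfactor (mu : {ffun node -> node}) : rel V := fun u w =>
  [&& a u w, ~~ (if mu (inr (u, w)) is inr _ then true else false)
           & ~~ (if mu (inr (w, u)) is inr _ then true else false)].

Lemma subfactor_sym mu : symmetric (subfactor mu).
Proof. by move=> u w; rewrite /subfactor asym; congr andb; rewrite andbC. Qed.

Lemma inr_matched mu u w : is_matching gadget nodes mu -> a u w ->
  [\/ mu (inr (u, w)) = inr (u, w), mu (inr (u, w)) = inr (w, u)
    | exists2 i : 'I_b, mu (inr (u, w)) = inl (u, i) & i < f u].
Proof.
move=> mat auw; have /is_matchingP[inv matr] := mat.
case: (eqVneq (mu (inr (u, w))) (inr (u, w))) => [|ne]; first by constructor 1.
have [_] := matr _ ne; have := matching_in mat (x := inr (u, w)); rewrite !inE => /(_ auw).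
case E: (mu (inr (u, w))) => [[v i]|[x y]] /=.
  by move=> ifv /eqP vu; constructor 3; exists i; rewrite -vu.
by move=> _ /and3P[/eqP-> /eqP-> _]; constructor 2.
Qed.

Lemma inl_matched mu v (i : 'I_b) : is_matching gadget nodes mu -> i < f v ->
  mu (inl (v, i)) = inl (v, i) \/ exists2 w, mu (inl (v, i)) = inr (v, w) & a v w.
Proof.
move=> mat ifv; have /is_matchingP[inv matr] := mat.
case: (eqVneq (mu (inl (v, i))) (inl (v, i))) => [|ne]; first by left.
have [_] := matr _ ne; have := matching_in mat (x := inl (v, i)); rewrite !inE => /(_ ifv).
case E: (mu (inl (v, i))) => [//|[x y]] /= axy /eqP vx; right.
by exists y; rewrite vx.
Qed.

(** A copy is bad if it yields no kept edge. It is charged to itself if unmatched, and otherwise to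
    the dart opposite to its partner, which is then unmatched; this charging is injective. *)
Lemma subfactor_degree mu : is_matching gadget nodes mu ->
  exists bad : {set V * 'I_b}, #|bad| <= #|unmatched nodes mu| /\
    forall v, f v = #|[set w | subfactor mu v w]| + #|[set i | (v, i) \in bad]|.
Proof.
move=> mat; have /is_matchingP[inv matr] := mat; have muI := can_inj inv.
pose good (p : V * 'I_b) := if mu (inl p) is inr q then subfactor mu p.1 q.2 else false.
exists [set p : V * 'I_b | (p.2 < f p.1) && ~~ good p]; split.
  pose psi (p : V * 'I_b) : node := if mu (inl p) is inr q then inr (q.2, q.1) else inl p.
  set bad := [set p | _].
  rewrite -(card_in_imset (f := psi) (D := bad)); last first.
    move=> p q _ _; rewrite /psi; case Ep: (mu (inl p)) => [x|[u w]];
      case Eq: (mu (inl q)) => [y|[u' w']] //=.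
      by case.
    by move=> [wE uE]; have /muI[] : mu (inl p) = mu (inl q) by rewrite Ep Eq wE uE.
  rewrite subset_leq_card //; apply/subsetP => _ /imsetP[[v i] + ->].
  rewrite inE /= => /andP[ifv nb]; move: nb; rewrite /good /psi inE.
  have [E|[w E avw]] := inl_matched mat ifv; rewrite E /=.
    by move=> _; rewrite inE /= ifv E eqxx.
  rewrite !inE /= asym avw /subfactor avw -{1}E inv /=.
  have awv : a w v by rewrite asym.
  have [->|E'|[j -> _]] := inr_matched mat awv; rewrite ?eqxx //.
  by move: (congr1 mu E'); rewrite inv -E inv.
move=> v; rewrite -[LHS](card_ord_ltn (fb v)) -(cardsID [set i : 'I_b | good (v, i)]);
  congr (_ + _); last first.
  by apply: eq_card => i; rewrite !inE andbC.
pose phi (i : 'I_b) := if mu (inl (v, i)) is inr q then q.2 else v.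
set D := _ :&: _; rewrite -(card_in_imset (f := phi) (D := D)); last first.
  move=> i j; rewrite !inE /good /phi => /andP[ifv gi] /andP[jfv gj].
  have [E|[w E _]] := inl_matched mat ifv; first by rewrite E in gi.
  have [E'|[w' E' _]] := inl_matched mat jfv; first by rewrite E' in gj.
  by rewrite E E' /= => ww; have /muI[] : mu (inl (v, i)) = mu (inl (v, j)) by rewrite E E' ww.
apply: eq_card => w; rewrite inE; apply/imsetP/idP => [[i + ->]|].
  rewrite !inE /good /phi => /andP[ifv]; case E: (mu (inl (v, i))) => [//|q] //.
move=> vw; have /and3P[avw m1 _] := vw.
have [E|E|[i E ifv]] := inr_matched mat avw; [by rewrite E in m1|by rewrite E in m1|].
have E' : mu (inl (v, i)) = inr (v, w) by rewrite -E inv.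
by exists i; rewrite ?inE /good /phi ?E' ?ifv.
Qed.

(** From a barrier [B] of the gadget, [S] collects the vertices with all copies in [B], and [T] the
    others with all darts in [B]. An unmatched node is a copy at [T], a dart at [S] whose opposite
    is in [B], or lies in the component of a copy of a remaining vertex. *)
Lemma gadget_barrier : (forall mu, is_matching gadget nodes mu -> 1 < #|unmatched nodes mu|) ->
  exists (S T : {set V}) (g : V -> node), [/\ [disjoint S & T],
    forall x y, x \notin S :|: T -> y \notin S :|: T -> a x y -> g x = g y &
    2 + \sum_(v in S) f v + \sum_(v in T) #|[set w | (w \notin S) && a v w]|
      <= \sum_(v in T) f v + #|g @: (~: (S :|: T))|].
Proof.
move=> def2; have [mu [B [nu [mat BX matnu le_U sep]]]] := tutte_berge gadget_sym gadget_irr nodes.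
have {def2 le_U} BU := leq_trans (leq_add (def2 _ mat) (leqnn #|B|)) le_U.
set Y := nodes :\: B in matnu sep BU; set U := unmatched Y nu in sep BU.
pose S := [set v | [forall i : 'I_b, (i < f v) ==> (inl (v, i) \in B)]].
pose T := [set v | (v \notin S) && [forall w, a v w ==> (inr (v, w) \in B)]].
(* [cp v] is a copy of [v] outside [B], whose component will label [v]. The default is never reached
   for [v] outside [S]. *)
have [cp cpP] : exists cp : V -> node, forall v, v \notin S ->
    exists2 i : 'I_b, cp v = inl (v, i) & inl (v, i) \in Y.
  exists (fun v => if [pick i : 'I_b | inl (v, i) \in Y] is Some i then inl (v, i) else inr (v, v)).
  move=> v; rewrite inE => /forallPn[i]; rewrite negb_imply => /andP[ifv iB].
  case: pickP => [j jY|/(_ i)]; first by exists j.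
  by rewrite !inE /= iB ifv.
have isym : connect_sym (induced gadget Y).
  by apply: sym_connect_sym => x y; rewrite /induced /= gadget_sym andbCA.
have step x y : x \in Y -> y \in Y -> gadget x y -> connect (induced gadget Y) x y.
  by move=> xY yY xy; apply: connect1; rewrite /induced /= xY yY.
have inrY u w : a u w -> inr (u, w) \notin B -> inr (u, w) \in Y by move=> auw nB;
  rewrite !inE /= nB.
pose g0 v := fingraph.root (induced gadget Y) (cp v).
have dart_cp u w : u \notin S -> a u w -> inr (u, w) \notin B ->
    connect (induced gadget Y) (inr (u, w)) (cp u).
  move=> uS auw nB; have [i -> iY] := cpP u uS.
  by apply: step => //; [exact: inrY | rewrite /= eqxx].
have CP v : v \notin S -> v \notin T -> exists2 w, a v w & inr (v, w) \notin B.
  move=> vS; rewrite inE vS /= => /forallPn[w]; rewrite negb_imply => /andP[]; by exists w.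
have copy_cp v i : v \notin S -> v \notin T -> inl (v, i) \in Y ->
    connect (induced gadget Y) (inl (v, i)) (cp v).
  move=> vS vT iY; have [w avw nB] := CP v vS vT.
  apply: connect_trans (dart_cp v w vS avw nB); apply: step => //; first exact: inrY.
  by rewrite /= eqxx.
pose C := ~: (S :|: T).
have CE v : (v \in C) = (v \notin S) && (v \notin T) by rewrite !inE negb_or.
pose Ua := [set x : node | if x is inl p then (p.1 \in T) && (p.2 < f p.1) else false].
pose Uc := [set x : node | if x is inr p then (p.1 \in S) && (inr (p.2, p.1) \in B) else false].
have Ub : #|U :\: (Ua :|: Uc)| <= #|g0 @: C|.
  rewrite -(card_in_imset (f := fingraph.root (induced gadget Y)) (D := U :\: (Ua :|: Uc)));
    last first.
    move=> x y /setDP[xU _] /setDP[yU _] /eqP; rewrite (root_connect isym); exact: sep.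
  rewrite subset_leq_card //; apply/subsetP => _ /imsetP[x + ->].
  move=> /setDP[xU]; rewrite in_setU negb_or => /andP[xa xc].
  have [xY /eqP nx] := setIdP xU; have xX : x \in nodes by case/setDP: xY.
  have nB : x \notin B by case/setDP: xY.
  suff [v vC cv] : exists2 v, v \in C & connect (induced gadget Y) x (cp v).
    by apply/imsetP; exists v => //; apply/eqP; rewrite (root_connect isym).
  case: x => [[v i]|[u w]] in xU xa xc xY nx xX nB *.
    have ifv : i < f v by move: xX; rewrite inE.
    have vS : v \notin S by rewrite inE; apply/forallPn; exists i; rewrite ifv.
    have vT : v \notin T by move: xa; rewrite inE /= ifv andbT.
    by exists v; [rewrite CE vS | exact: copy_cp].
  have auw : a u w by move: xX; rewrite inE.
  have awu : a w u by rewrite asym.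
  case: (boolP (u \in S)) => uS; last first.
    exists u; last exact: dart_cp.
    by rewrite CE uS /= inE uS /=; apply/forallPn; exists w; rewrite auw.
  have wuB : inr (w, u) \notin B by move: xc; rewrite inE /= uS.
  have wuY := inrY w u awu wuB.
  have uw : connect (induced gadget Y) (inr (u, w)) (inr (w, u)).
    by apply: step => //; rewrite /= !eqxx.
  (* The opposite dart shares the component of the unmatched [inr (u, w)], so it is matched, and to
     a copy of [w]; hence [w] is outside [S]. *)
  have /is_matchingP[inv matr] := matnu.
  case: (eqVneq (nu (inr (w, u))) (inr (w, u))) => [nwu|ne].
    have wuU : inr (w, u) \in U by rewrite inE wuY nwu eqxx.
    by have [E _] := sep _ _ xU wuU uw; rewrite E airr in auw.
  have [_] := matr _ ne; have := matching_in matnu wuY.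
  case E: (nu (inr (w, u))) => [[v i]|[x y]] /=.
    move=> iY /eqP vw; rewrite vw in iY.
    have wS : w \notin S.
      by rewrite inE; apply/forallPn; exists i; rewrite negb_imply; move: iY;
        rewrite !inE /= => /andP[-> ->].
    exists w; first by rewrite CE wS /= inE wS /=; apply/forallPn; exists u; rewrite awu.
    by apply: connect_trans uw _; apply: dart_cp.
  move=> _ /and3P[/eqP wy /eqP ux _]; rewrite -wy -ux in E.
  have E' := inv (inr (w, u)); rewrite E nx in E'.
  by case: E' => uw' _; rewrite uw' airr in auw.
have FS v (i : 'I_b) : v \in S -> i < f v -> inl (v, i) \in B.
  by rewrite inE => /forallP/(_ i)/implyP.
have FT v w : v \in T -> a v w -> inr (v, w) \in B.
  by rewrite inE => /andP[_ /forallP/(_ w)/implyP].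
have TS v : v \in T -> v \notin S by rewrite inE => /andP[].
clearbody T; clearbody S.
have cUa : #|Ua| <= \sum_(v in T) f v.
  have -> : \sum_(v in T) f v = #|[set p : V * 'I_b | (p.1 \in T) && (p.2 < f p.1)]|.
    rewrite (card_pairs (mem T) (fun v (i : 'I_b) => i < f v)).
    by apply: eq_bigr => v _; rewrite card_ord_ltn.
  apply: leq_trans (leq_imset_card (fun p => inl p : node) _); apply: subset_leq_card.
  by apply/subsetP => -[p|p]; rewrite inE // => pU; apply: imset_f; rewrite inE.
pose BS := [set p : V * V | (p.2 \in S) && (inr p \in B)].
pose BC := [set p : V * V | (p.1 \in C) && ((p.2 \notin S) && (inr p \in B))].
pose BT := [set p : V * V | (p.1 \in T) && ((p.2 \notin S) && a p.1 p.2)].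
have cUc : #|Uc| <= #|BS|.
  apply: leq_trans (leq_imset_card (fun p => inr (p.2, p.1) : node) _); apply: subset_leq_card.
  apply/subsetP => -[p|[u w]]; rewrite inE // => pU.
  by apply/imsetP; exists (w, u); rewrite // inE.
pose BF := [set p : V * 'I_b | (p.1 \in S) && (p.2 < f p.1)].
have cB : #|BF| + (#|BS| + #|BT| + #|BC|) <= #|B|.
  have inlI : injective (@inl (V * 'I_b) (V * V)) by move=> ? ? [].
  have inrI : injective (@inr (V * 'I_b) (V * V)) by move=> ? ? [].
  have dis1 : BS :&: BT = set0.
    by apply/setP => p; rewrite !inE; case: (p.2 \in S); rewrite ?andbF //= andbF.
  have dis2 : (BS :|: BT) :&: BC = set0.
    apply/setP => p; rewrite in_set0 in_setI in_setU /BC [p \in BS]inE [p \in BT]inE inE CE.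
    by case: (p.1 \in T); case: (p.2 \in S); rewrite ?andbF //= ?andbF.
  have := cardsUI BS BT; rewrite dis1 cards0 addn0 => <-.
  have := cardsUI (BS :|: BT) BC; rewrite dis2 cards0 addn0 => <-.
  rewrite -(card_imset BF inlI) -(card_imset (BS :|: BT :|: BC) inrI) -cardsUI.
  rewrite (_ : _ :&: _ = set0) ?cards0 ?addn0; last first.
    by apply/setP => x; rewrite in_set0; apply/setIP => -[/imsetP[p _ ->] /imsetP[q _]].
  rewrite subset_leq_card // subUset; apply/andP; split; apply/subsetP => _ /imsetP[p + ->].
    by case: p => v i; rewrite inE /= => /andP[]; apply: FS.
  case: p => u w; rewrite !in_setU [_ \in BS]inE [_ \in BT]inE [_ \in BC]inE /=.
  move=> /orP[/orP[/andP[_ //]|/and3P[uT _ auw]]|/and3P[//]].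
  exact: FT.
have cBF : #|BF| = \sum_(v in S) f v.
  rewrite /BF (card_pairs (mem S) (fun v (i : 'I_b) => i < f v)).
  by apply: eq_bigr => v _; rewrite card_ord_ltn.
have cBT : #|BT| = \sum_(v in T) #|[set w | (w \notin S) && a v w]|.
  exact: (card_pairs (mem T) (fun v w => (w \notin S) && a v w)).
(* Adjacent vertices of [C] may have different labels if a dart of their edge is in [B]. Merging
   them costs one label per element of [BC], which the size of [B] pays for. *)
have [g [g1 g2 g3]] := merge_labels g0 C (enum BC).
exists S, T, g; split.
- by rewrite disjoint_sym disjoints_subset; apply/subsetP => v /TS; rewrite inE.
- move=> x y; rewrite -!in_setC -/C => xC yC axy; have ayx : a y x by rewrite asym.
  have [/andP[xS xT] /andP[yS yT]] : ((x \notin S) && (x \notin T)) /\ ((y \notin S) && (y \notin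
    T)).
    by rewrite -!CE.
  case: (boolP (inr (x, y) \in B)) => xyB.
    by apply: (g2 (x, y)); rewrite mem_enum inE xC yS.
  case: (boolP (inr (y, x) \in B)) => yxB.
    by apply/esym/(g2 (y, x)); rewrite mem_enum inE yC xS.
  apply: g1; apply/eqP; rewrite (root_connect isym).
  apply: connect_trans (dart_cp y x yS ayx yxB); rewrite isym.
  apply: connect_trans (dart_cp x y xS axy xyB).
  by apply: step; rewrite ?inrY //= !eqxx.
rewrite -cBF -cBT -/C; move: g3; rewrite -cardE => g3.
have UE : #|U| <= #|U :\: (Ua :|: Uc)| + #|Ua| + #|Uc|.
  rewrite -(cardsID (Ua :|: Uc) U) addnC -addnA leq_add2l.
  by apply: leq_trans (leq_card_setU _ _); rewrite subset_leq_card ?subsetIr.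
have arith u uabc ua uc gg0 gg bc bs bt bf bb sf : 2 + bb <= u -> u <= uabc + ua + uc -> uabc <=
  gg0 ->
  gg0 <= gg + bc -> ua <= sf -> uc <= bs -> bf + (bs + bt + bc) <= bb -> 2 + bf + bt <= sf + gg.
  by clear; lia.
exact: arith BU UE Ub g3 cUa cUc cB.
Qed.

End Gadget.

(** * Near f-factors in tough graphs *)

Section NearFactor.
Variables (V : finType) (a : rel V).
Hypothesis asym : symmetric a.
Hypothesis airr : irreflexive a.
Variables (b : nat) (f : V -> nat).
Hypothesis b2 : 1 < b.
Hypothesis f2b : forall v, 2 <= f v <= b.
Hypothesis bV : b ^ 2 <= #|V|.
Hypothesis tough_a : forall (L : finType) (S : {set V}) (g : V -> L),
  (forall x y, x \notin S -> y \notin S -> a x y -> g x = g y) ->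
  #|g @: (~: S)| <= 1 \/ b ^ 2 * #|g @: (~: S)| <= #|S|.

Definition nbrs (S : {set V}) v : {set V} := [set w | (w \notin S) && a v w].

(** Repeatedly take a vertex with the fewest neighbours outside [S], say [d], and drop it with these
    neighbours. At most [d + 1] vertices of [Y] go, each of weight at most [b - d]. *)
Lemma greedy_independent (S Y : {set V}) : [disjoint Y & S] -> exists I : {set V},
  [/\ I \subset Y, forall x y, x \in I -> y \in I -> ~~ a x y,
   \sum_(v in Y) (b - #|nbrs S v|) <= \sum_(i in I) #|nbrs S i|.+1 * (b - #|nbrs S i|) &
   #|Y| <= \sum_(i in I) #|nbrs S i|.+1].
Proof.
have [n] := ubnP #|Y|; elim: n Y => // n IH Y Yn YS.
have [->|[y0 y0Y]] := set_0Vmem Y.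
  by exists set0; rewrite !big_set0 cards0; split=> // x y; rewrite inE.
case: (@arg_minnP _ y0 [in Y] (fun v => #|nbrs S v|) y0Y) => y yY miny.
pose Y' := Y :\: (y |: nbrs S y).
have Y'Y : Y' \subset Y by apply: subsetDl.
have Y'n : #|Y'| < n.
  rewrite -ltnS; apply: leq_trans Yn; rewrite ltnS; apply: proper_card.
  by apply/properP; split=> //; exists y; rewrite // !inE eqxx.
have [I [IY' indI sumI cI]] := IH Y' Y'n (disjointWl Y'Y YS).
have nyI x : x \in I -> ~~ a y x.
  move=> /(subsetP IY'); rewrite !inE !negb_or => /andP[/andP[_ nxy] xY].
  by move: nxy; rewrite (disjointFr YS xY).
have yI : y \notin I by apply/negP => /(subsetP IY'); rewrite !inE eqxx.
have cN : #|Y :&: (y |: nbrs S y)| <= #|nbrs S y|.+1.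
  apply: leq_trans (subset_leq_card (subsetIr _ _)) _.
  by rewrite cardsU1 -add1n leq_add2r leq_b1.
exists (y |: I); split.
- by rewrite subUset sub1set yY (subset_trans IY').
- move=> x z; rewrite !inE => /orP[/eqP->|xI] /orP[/eqP->|zI].
  + by rewrite airr.
  + exact: nyI.
  + by rewrite asym nyI.
  + exact: indI.
- rewrite big_setU1 //= (big_setID (y |: nbrs S y)) /=; apply: leq_add => //.
  apply: leq_trans (leq_mul cN (leqnn _)); rewrite -sum_nat_const; apply: leq_sum => v /setIP[vY _].
  by rewrite leq_sub2l // miny.
- by rewrite big_setU1 //= -(cardsID (y |: nbrs S y) Y) leq_add.
Qed.

(** Deleting [S] and the neighbours of [I] isolates the vertices of [I]. If only one label remains,
    [I] is a single vertex and nothing else survives, so the lower bound on [#|V|] applies. *)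
Lemma independent_tough (S I : {set V}) : [disjoint I & S] ->
  (forall x y, x \in I -> y \in I -> ~~ a x y) ->
  [\/ #|I| = 0, b ^ 2 * #|I| <= #|S| + \sum_(i in I) #|nbrs S i| |
   #|I| = 1 /\ b ^ 2 <= #|S| + \sum_(i in I) #|nbrs S i|.+1].
Proof.
move=> IS indI; case: (posnP #|I|) => [|I0]; first by constructor 1.
pose S' := S :|: \bigcup_(i in I) nbrs S i.
have cS' : #|S'| <= #|S| + \sum_(i in I) #|nbrs S i|.
  apply: leq_trans (leq_card_setU _ _) _; rewrite leq_add2l.
  elim/big_rec2: _ => [|i k X _ le]; first by rewrite cards0.
  by apply: leq_trans (leq_card_setU _ _) _; rewrite leq_add2l.
have IS' x : x \in I -> x \notin S'.
  move=> xI; rewrite inE (disjointFr IS xI) /=; apply/bigcupP => -[i iI].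
  by rewrite inE (negbTE (indI _ _ iI xI)) andbF.
pose h x := if x \in I then Some x else None.
have hS' x y : x \notin S' -> y \notin S' -> a x y -> h x = h y.
  have out u v : u \in I -> v \notin S' -> a u v -> false.
    move=> uI vS' auv; move: vS'; rewrite inE negb_or => /andP[vS /bigcupP[]].
    by exists u => //; rewrite inE vS.
  move=> xS' yS' axy; rewrite /h; case: (boolP (x \in I)) => xI;
    first by have := out x y xI yS' axy.
  by case: (boolP (y \in I)) => // yI; have := out y x yI xS'; rewrite asym => /(_ axy).
have hI : Some @: I \subset h @: (~: S').
  apply/subsetP => _ /imsetP[x xI ->]; apply/imsetP; exists x; first by rewrite inE IS'.
  by rewrite /h xI.
have cI : #|I| <= #|h @: (~: S')| by rewrite -(card_imset I Some_inj) subset_leq_card.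
have [h1|hb] := tough_a hS'; last first.
  by constructor 2; apply: leq_trans cS'; apply: leq_trans hb; rewrite leq_mul2l cI orbT.
constructor 3; have I1 : #|I| = 1 by apply/eqP; rewrite eqn_leq (leq_trans cI).
split=> //; apply: leq_trans bV _.
have : [set: V] \subset S' :|: I.
  apply/subsetP => z _; rewrite in_setU; apply/orP; case: (boolP (z \in S')) => zS';
    [by left | right].
  apply: contraT => zI; move: h1; rewrite leqNgt => /negP[].
  have [x xI] := card_gt0P I0; apply/card_gt1P; exists (h x), (h z); split.
  - by apply: imset_f; rewrite inE IS'.
  - by apply: imset_f; rewrite inE.
  - by rewrite /h xI (negbTE zI).
move=> /subset_leq_card; rewrite cardsT => /leq_trans; apply.
apply: leq_trans (leq_card_setU _ _) _; rewrite (eq_bigr (fun i => #|nbrs S i| + 1));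
  last by move=> i _; rewrite addn1.
by rewrite big_split /= sum1_card addnA leq_add2r.
Qed.

(** Only [T1] works in favour of the barrier. If toughness bites on the greedy set [I], the weight
    of [T1] is at most [#|S|] and [#|T1| <= 2 * #|S|]. Then more than [#|S| + #|T2|] labels survive
    the deletion of at most [3 * #|S| + #|T2|] vertices, which [4 <= b ^ 2] forbids. *)
Lemma no_barrier (L : finType) (S T : {set V}) (g : V -> L) : [disjoint S & T] ->
  (forall x y, x \notin S :|: T -> y \notin S :|: T -> a x y -> g x = g y) ->
  2 + \sum_(v in S) f v + \sum_(v in T) #|nbrs S v| <= \sum_(v in T) f v + #|g @: (~: (S :|: T))| ->
  False.
Proof.
move=> ST gST bar; pose T1 := [set v in T | #|nbrs S v| <= f v]; pose T2 := T :\: T1.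
have T1T : T1 \subset T by apply/subsetP => v; rewrite inE => /andP[].
have T1S : [disjoint T1 & S] by apply: disjointWl T1T _; rewrite disjoint_sym.
have [I [IT1 indI sumI cT1]] := greedy_independent T1S.
have sumT : \sum_(v in T) f v + #|T2| <= \sum_(v in T) #|nbrs S v| + \sum_(v in T1) (b - #|nbrs S
  v|).
  rewrite (big_setID T1) /= (setIidPr T1T) [X in _ <= X + _](big_setID T1) /= (setIidPr T1T).
  rewrite -/T2 -addnA addnAC leq_add //.
    rewrite -big_split /=; apply: leq_sum => v; rewrite inE => /andP[_ le];
      have /andP[_ fb] := f2b v.
    by apply: leq_trans fb _; rewrite -leq_subLR.
  rewrite -sum1_card -big_split /=; apply: leq_sum => v; rewrite !inE => /andP[+ vT].
  by rewrite vT /= -ltnNge addn1.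
have sumS : 2 * #|S| <= \sum_(v in S) f v.
  by rewrite mulnC -sum_nat_const; apply: leq_sum => v _; case/andP: (f2b v).
have cST : #|S :|: T| <= #|S| + #|T1| + #|T2|.
  by apply: leq_trans (leq_card_setU _ _) _;
    rewrite -addnA leq_add2l -(cardsID T1 T) (setIidPr T1T).
have dI i : i \in I -> #|nbrs S i| <= b.
  move=> /(subsetP IT1); rewrite inE => /andP[_ le]; apply: leq_trans le _.
  by case/andP: (f2b i).
have tST := tough_a gST.
have {}bar : 2 + 2 * #|S| + #|T2| <= \sum_(v in T1) (b - #|nbrs S v|) + #|g @: (~: (S :|: T))|.
  have arith sf st tf t2 w q s : 2 + sf + st <= tf + q -> tf + t2 <= st + w -> 2 * s <= sf -> 2 +
    2 * s + t2 <= w + q.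
    by clear; lia.
  exact: arith bar sumT sumS.
have main w t1 s t2 q st : 2 + 2 * s + t2 <= w + q -> w <= s -> t1 <= 2 * s -> st <= s + t1 + t2 ->
    q <= 1 \/ b ^ 2 * q <= st -> False.
  have b4 : 4 <= b ^ 2 by rewrite -[4]/(2 ^ 2) leq_exp2r.
  move=> h1 h2 h3 h4 [q1|q2]; first by move: h1 h2 q1; clear; lia.
  have : 4 * q <= b ^ 2 * q by rewrite leq_mul2r b4 orbT.
  by move: h1 h2 h3 h4 q2; clear; lia.
have [I0|Ib|[/eqP/cards1P[i Ii] IV]] := independent_tough (disjointWl IT1 T1S) indI.
- have IE : I = set0 by apply/eqP; rewrite -cards_eq0 I0.
  move: sumI cT1; rewrite IE !big_set0 !leqn0 => /eqP w0 /eqP t10.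
  by apply: (main _ _ _ _ _ _ bar _ _ cST tST); rewrite ?w0 ?t10.
(* This bound and the next sum over [I] the inequalities [(d + 1)(b - d) + d <= b ^ 2] and
   [3d + 1 <= 2 b ^ 2], valid for [d <= b]. *)
- have wS : \sum_(v in T1) (b - #|nbrs S v|) <= #|S|.
    apply: leq_trans sumI _; rewrite -(leq_add2r (\sum_(i in I) #|nbrs S i|)); apply: leq_trans Ib.
    rewrite -big_split mulnC -sum_nat_const /=; apply: leq_sum => i /dI.
    by move: #|_| => d; move: b2; clear; rewrite -mulnn; nia.
  have t1S : #|T1| <= 2 * #|S|.
    apply: leq_trans cT1 _; rewrite -(leq_add2r (2 * \sum_(i in I) #|nbrs S i|)) -mulnDr.
    apply: leq_trans (leq_mul (leqnn 2) Ib);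
      rewrite big_distrr -big_split /= mulnA mulnC -sum_nat_const.
    apply: leq_sum => i /dI; move: #|_| => d; move: b2; clear; rewrite -mulnn; nia.
  exact: (main _ _ _ _ _ _ bar wS t1S cST tST).
(* Here only [b ^ 2 <= s + d + 1] is known and the weight may exceed [s] by one; [d + 1 < b ^ 2]
   makes up for it. *)
move: sumI cT1 IV dI tST cST bar; rewrite Ii !big_set1 => sumI cT1 IV /(_ i);
  rewrite inE => /(_ (eqxx i)).
move: #|nbrs S i| sumI cT1 IV => d; move: (\sum_(v in T1) _) => w;
  move: #|T1| #|T2| #|S| => t1 t2 s.
move: #|g @: _| #|S :|: T| => q st sumI cT1 IV db tST cST bar.
have ws : w <= s.+1.
  apply: leq_trans sumI _; move: b2 IV db; clear; rewrite -mulnn; nia.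
have bb : 2 * b <= b ^ 2 by rewrite -mulnn leq_mul2r b2 orbT.
have s1 : 1 <= s by move: bb b2 IV db; clear; move: (b ^ 2) => B; lia.
have q2 : 1 + s + t2 <= q by move: bar ws; clear; lia.
case: tST => [q1|bq]; first by move: q1 q2 s1; clear; lia.
have : b ^ 2 * (1 + (s + t2)) <= b ^ 2 * q by rewrite leq_mul2l addnA q2 orbT.
have : s + t2 <= b ^ 2 * (s + t2) by rewrite leq_pmull // expn_gt0 ltnW.
rewrite (mulnDr _ 1) muln1; move: bq cST cT1 db bb b2; clear; move: (b ^ 2) => B; lia.
Qed.

Lemma tough_degree v : b <= #|[set w | a v w]|.
Proof.
have n0 : nbrs set0 v = [set w | a v w] by apply/setP => w; rewrite !inE.
have [||I1|Ib|[_ Ib]] := @independent_tough set0 [set v].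
- by rewrite disjoints_subset setC0 subsetT.
- by move=> x y /set1P -> /set1P ->; rewrite airr.
- by rewrite cards1 in I1.
- rewrite big_set1 cards1 cards0 n0 muln1 in Ib; apply: leq_trans Ib.
  by rewrite -mulnn leq_pmull // ltnW.
- rewrite big_set1 cards0 n0 in Ib.
  have : b < b ^ 2 by rewrite -[ltnLHS]muln1 -mulnn ltn_pmul2l // ltnW.
  by move=> /leq_trans/(_ Ib).
Qed.

Lemma near_factor : exists (H : rel V) (Z : {set V}),
  [/\ symmetric H, subrel H a, #|Z| <= 1 &
   forall v, #|[set w | H v w]| = f v + (v \in Z)].
Proof.
have fb v : f v <= b by case/andP: (f2b v).
have [mu mat def1] : exists2 mu : {ffun node V b -> node V b}, is_matching (gadget (b := b) a)
  (nodes a b f) mu &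
    #|unmatched (nodes a b f) mu| <= 1.
  case: (boolP [exists mu : {ffun node V b -> node V b}, is_matching (gadget (b := b) a) (nodes a
    b f) mu &&
    (#|unmatched (nodes a b f) mu| <= 1)]) => [/existsP[mu /andP[]]|/existsPn no];
      first by exists mu.
  have def2 (mu : {ffun node V b -> node V b}) : is_matching (gadget (b := b) a) (nodes a b f) mu
    -> 1 < #|unmatched (nodes a b f) mu|.
    by move=> mat; have := no mu; rewrite mat /= ltnNge.
  have [S [T [g [ST gST bar]]]] := gadget_barrier asym airr fb def2.
  by case: (no_barrier ST gST bar).
have [bad [cbad badE]] := subfactor_degree asym fb mat.
have F_sym := subfactor_sym asym mu.
pose F := subfactor a mu; rewrite -/F in F_sym badE.
have Fa : subrel F a by move=> x y /and3P[].
have [bad0|[[v0 i0] badp]] := set_0Vmem bad.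
  exists F, set0; split=> //; first by rewrite cards0.
  move=> v; rewrite inE addn0 (badE v) bad0.
  have -> : [set i | (v, i) \in set0] = set0 :> {set 'I_b} by apply/setP => i; rewrite !inE.
  by rewrite cards0 addn0.
have badE0 : bad = [set (v0, i0)].
  by apply/esym/eqP; rewrite eqEcard sub1set badp cards1 (leq_trans cbad).
have degF v : f v = #|[set w | F v w]| + (v == v0).
  rewrite (badE v) badE0; congr (_ + _); case: (eqVneq v v0) => [->|vv0].
    rewrite -[RHS](cards1 i0); apply: eq_card => i; rewrite !inE.
    by apply/eqP/eqP => [[]|->].
  apply/eqP; rewrite cards_eq0; apply/eqP/setP => i; rewrite !inE; apply/eqP => -[vE _].
  by rewrite vE eqxx in vv0.
have [w0 aw0 Fw0] : exists2 w, a v0 w & ~~ F v0 w.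
  have : ~~ ([set w | a v0 w] \subset [set w | F v0 w]).
    apply/negP => /subset_leq_card; rewrite leqNgt => /negP[].
    apply: leq_trans (tough_degree v0); apply: leq_trans (fb v0).
    by rewrite (degF v0) eqxx addn1.
  by case/subsetPn => w; rewrite !inE; exists w.
have vw : v0 != w0 by apply: contraTneq aw0 => ->; rewrite airr.
pose H : rel V := fun x y => [|| F x y, (x == v0) && (y == w0) | (x == w0) && (y == v0)].
exists H, [set w0]; split; last 1 first.
- move=> v; rewrite inE (degF v); case: (eqVneq v v0) => [->|vv0].
    have -> : [set w | H v0 w] = w0 |: [set w | F v0 w].
      by apply/setP => w; rewrite !inE /H eqxx (negbTE vw) /= orbF orbC.
    by rewrite cardsU1 inE Fw0 (negbTE vw) addn0 addnC.
  case: (eqVneq v w0) => [->|vw0].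
    have -> : [set w | H w0 w] = v0 |: [set w | F w0 w].
      by apply/setP => w; rewrite !inE /H eqxx eq_sym (negbTE vw) /= orbC.
    by rewrite cardsU1 inE F_sym Fw0 addn0 addnC.
  by rewrite !addn0; apply: eq_card => w; rewrite !inE /H (negbTE vv0) (negbTE vw0) !orbF.
- by move=> x y; rewrite /H F_sym orbA orbAC -orbA ![(y == _) && _]andbC.
- by move=> x y /or3P[/Fa//|/andP[/eqP-> /eqP->]//|/andP[/eqP-> /eqP->]]; rewrite asym.
- by rewrite cards1.
Qed.

End NearFactor.

(** * The factor theorem *)

Lemma simple_edge_set (G : mgraph) (H : rel G) : symmetric H ->
  (forall x y, H x y -> exists e : edge G, ends e = [set x; y]) ->
  exists2 F : {set edge G}, {in F &, injective (@ends G)} &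
    forall v, deg F v = #|[set w | H v w]|.
Proof.
move=> Hsym Hedge.
(* [pick] selects one representative of each class of parallel edges. *)
pose F := [set e : edge G | ([pick e' | ends e' == ends e] == Some e)
  && [exists x, exists y, H x y && (ends e == [set x; y])]].
have simF : {in F &, injective (@ends G)}.
  by move=> e e'; rewrite !inE => /andP[/eqP pe _] /andP[/eqP pe' _] ee; move: pe';
    rewrite -ee pe => -[].
have Hirr x : H x x = false.
  apply/negP => /Hedge[e eE]; have := endsP e; rewrite eE setUid cards1 //.
exists F => // v; rewrite /deg -(card_in_imset (f := fun e : edge G => ends e :\ v)); last first.
  move=> e e'; rewrite !inE => /andP[eF ve] /andP[e'F ve'] ee.
  by apply: simF; rewrite ?inE // -(setD1K ve) -(setD1K ve') ee.
rewrite -[RHS](card_imset _ (@set1_inj _)); apply: eq_card => X; apply/imsetP/imsetP => -[].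
  move=> e; rewrite !inE => /andP[/andP[_ /existsP[x /existsP[y /andP[xy /eqP eE]]]] ve] ->.
  move: ve; rewrite eE !inE => /orP[]/eqP->; [exists y | exists x]; rewrite ?inE ?[H y x]Hsym //.
    by apply/setP => w; rewrite !inE; case: (eqVneq w x) => [->|//]; apply/esym/negP => /eqP xE;
      rewrite -xE Hirr in xy.
  by apply/setP => w; rewrite !inE orbC; case: (eqVneq w y) => [->|//];
    apply/esym/negP => /eqP xE; rewrite xE Hirr in xy.
move=> w; rewrite inE => vw ->; have [e eE] := Hedge v w vw.
case Ee: [pick e' | ends e' == [set v; w]] => [e'|]; last first.
  by move: Ee; case: pickP => // /(_ e); rewrite eE eqxx.
have e'E : ends e' = [set v; w] by move: Ee; case: pickP => // u /eqP uE [<-].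
exists e'.
  rewrite !inE e'E Ee eqxx !inE eqxx /= andbT; apply/existsP; exists v; apply/existsP; exists w.
  by rewrite vw eqxx.
rewrite e'E; apply/setP => u; rewrite !inE; case: (eqVneq u v) => [->|//].
by apply/eqP => vE; rewrite -vE Hirr in vw.
Qed.

Theorem corollary4p3 (R : realFieldType) (G : mgraph) (b m : nat) (f : G -> nat)
  (hb : 0 < b) (hm : 0 < m)
  (hf0 : forall v : G, 0 < f v)
  (hf : forall v : G, 2 * m <= f v <= b)
  (hG : tough ((b ^ 2)%:R%R : R) G)
  (hV : b ^ 2 <= #|G|) :
  exists H : {set edge G}, tree_connected m H /\ factor_f_f1 f H.
Proof.
have b20 : 0 < b ^ 2 by rewrite expn_gt0 hb.
have inhG : 0 < #|G| by apply: leq_trans hV.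
have mb : 2 * m <= b.
  by have [v _] := card_gt0P inhG; have /andP[h1 h2] := hf v; apply: leq_trans h2.
have m2 : 2 <= 2 * m by rewrite -[leqLHS]muln1 leq_mul2l.
pose a : rel G := fun x y => [exists e : edge G, ends e == [set x; y]].
have asym : symmetric a by move=> x y; apply: eq_existsb => e; rewrite setUC.
have airr : irreflexive a.
  move=> x; apply/existsP => -[e /eqP eE]; have := endsP e; by rewrite eE setUid cards1.
have f2b v : 2 <= f v <= b by have /andP[h1 h2] := hf v; rewrite h2 (leq_trans m2 h1).
have tough_a (L : finType) (S : {set G}) (g : G -> L) :
    (forall x y, x \notin S -> y \notin S -> a x y -> g x = g y) ->
    #|g @: (~: S)| <= 1 \/ b ^ 2 * #|g @: (~: S)| <= #|S|.
  move=> gS; apply: (tough_label b20 hG) => e x y xe ye xS yS.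
  case: (eqVneq x y) => [->//|xy]; apply: gS => //; apply/existsP; exists e.
  by rewrite eq_sym eqEcard (endsP e) cards2 xy subUset !sub1set xe ye.
have [H [Z [Hsym Ha Z1 Hdeg]]] := near_factor asym airr (leq_trans m2 mb) f2b hV tough_a.
have [F simF degF] := simple_edge_set Hsym (fun x y xy => 
  let: ex_intro e eE := existsP (Ha x y xy) in ex_intro _ e (eqP eE)).
have degF2 v : 2 * m <= deg F v.
  by rewrite degF Hdeg (leq_trans _ (leq_addr _ _)) //; case/andP: (hf v).
have [M [MF MZ maM treeM]] := tree_connected_extension hm mb hG inhG simF degF2 Z1.
exists (F :|: M); split=> // v.
have -> : deg (F :|: M) v = deg F v + deg M v.
  rewrite /deg -cardsUI (_ : _ :&: _ = set0); last first.
    apply/setP => e; rewrite !inE; case: (boolP (e \in M)) => eM; last by rewrite !andbF.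
    by rewrite (disjointFr MF eM).
  by rewrite cards0 addn0; apply: eq_card => e; rewrite !inE andb_orl.
have degM : deg M v <= 1.
  by apply/card_le1_eqP => e e' /setIdP[eM ve] /setIdP[e'M ve']; apply: (maM e' e v).
(* A vertex of [Z] already has degree [f + 1] and is avoided by [M]; any other has degree [f] and
   gains at most one. *)
rewrite degF Hdeg; case: (boolP (v \in Z)) => vZ.
  right; rewrite addn1 (_ : deg M v = 0) ?addn0 //; apply/eqP; rewrite cards_eq0;
    apply/eqP/setP => e.
  rewrite !inE; apply/negP => /andP[eM ve]; by have := disjointFr (MZ e eM) ve; rewrite vZ.
move: degM; case: (deg M v) => [|[|//]] _; rewrite addn0 ?addn0 ?addn1; by [left | right].
Qed.
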